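(* Let $X$ be an infinite-dimensional complex Banach space, let $R\in\mathcal{B}(X)$ be a Riesz operator and let $T\in\mathcal{B}(X)$ commute with $R$. If $T$ satisfies property $(Z_{E_a})$, then the following statements are equivalent: (i) $T+R$ satisfies property $(Z_{E_a})$; (ii) $E_a(T+R)=\Pi^0(T+R)$; (iii) $E_a(T+R)\cap\sigma(T)\subset\Pi^0(T)$.
   Context: $\mathcal{B}(X)$ is the algebra of bounded linear operators on $X$ and $I$ is the identity. For $S\in\mathcal{B}(X)$, $\mathcal{N}(S)$ and $\mathcal{R}(S)$ are its null space and range, $\sigma(S)$ its spectrum, and $\sigma_a(S)$ its approximate point spectrum ($\lambda\in\sigma_a(S)$ iff $S-\lambda I$ is not bounded below). $S\in\mathcal{B}(X)$ is Fredholm if $\dim\mathcal{N}(S)<\infty$ and $\operatorname{codim}\mathcal{R}(S)<\infty$, with index $\dim\mathcal{N}(S)-\operatorname{codim}\mathcal{R}(S)$; it is Weyl if it is Fredholm of index $0$. The Weyl spectrum is $\sigma_W(S)=\{\lambda\in\mathbb{C}: S-\lambda I \text{ is not Weyl}\}$. An operator $R\in\mathcal{B}(X)$ is Riesz if $R-\mu I$ is Fredholm for every nonzero $\mu\in\mathbb{C}$. The ascent and descent of $S$ are $a(S)=\inf\{n\in\mathbb{N}:\mathcal{N}(S^n)=\mathcal{N}(S^{n+1})\}$ and $\delta(S)=\inf\{n\in\mathbb{N}:\mathcal{R}(S^n)=\mathcal{R}(S^{n+1})\}$, with $\mathbb{N}=\{0,1,2,\dots\}$ and $\inf\emptyset=\infty$.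 $\lambda\in\sigma(S)$ is a pole of $S$ if $S-\lambda I$ has finite ascent and finite descent; it is of finite rank if $\dim\mathcal{N}(S-\lambda I)<\infty$. $\Pi^0(S)$ is the set of poles of $S$ of finite rank. $\mathrm{iso}\,A$ denotes the set of isolated points of $A\subset\mathbb{C}$, $\sigma_p(S)$ the set of eigenvalues of $S$, and $E_a(S)=\mathrm{iso}\,\sigma_a(S)\cap\sigma_p(S)$. $S$ satisfies property $(Z_{E_a})$ if $\sigma(S)\setminus\sigma_W(S)=E_a(S)$. *)

(* Defs.v *)
From HB Require Import structures.
From mathcomp Require Import all_boot all_order all_algebra.
From mathcomp Require Import all_classical all_reals all_analysis.
From mathcomp Require Import complex.

Set Implicit Arguments.
Unset Strict Implicit.
Unset Printing Implicit Defensive.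

Import Order.TTheory GRing.Theory Num.Theory.
Import numFieldNormedType.Exports.

Local Open Scope classical_set_scope.
Local Open Scope ring_scope.

(* [R[i]] seen as a [numFieldType], so that subsets of the complex plane get
   the norm topology that the library puts on every [numFieldType]. *)
Definition Cplx (R : realType) : numFieldType := R[i].

Section Dimension.
Variables (R : realType) (X : lmodType (Cplx R)).
Implicit Types V W : set X.

(* The classes of [e 0, ..., e (n - 1)] form a basis of the quotient [V / W],
   for linear subspaces [W] included in [V]. *)
Definition quotient_basis V W n (e : 'I_n -> X) :=
  [/\ forall i, V (e i),
      forall c : 'I_n -> Cplx R, W (\sum_i c i *: e i) -> forall i, c i = 0
    & forall x, V x -> exists c : 'I_n -> Cplx R, W (x - \sum_i c i *: e i)].

Definition has_dim V (n : nat) :=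
  exists e : 'I_n -> X, quotient_basis V [set 0] e.

Definition has_codim V (n : nat) :=
  exists e : 'I_n -> X, quotient_basis [set: X] V e.

Definition finite_dim V := exists n, has_dim V n.

Definition finite_codim V := exists n, has_codim V n.

(* Junk value 0 when the dimension (codimension) is infinite. *)
Definition dim V : nat := xget 0%N [set n | has_dim V n].

Definition codim V : nat := xget 0%N [set n | has_codim V n].

End Dimension.

(* The notions below are stated for bare maps [S : X -> X], but they are meant
   for bounded linear operators. *)
Section Operators.
Variables (R : realType) (X : completeNormedModType (Cplx R)).
Implicit Types (S : X -> X) (l m : Cplx R).

Definition bounded_op S :=
  exists M : Cplx R, forall x, `|S x| <= M * `|x|.

Definition shift_op S l : X -> X := fun x => S x - l *: x.

Definition null_space S : set X := [set x | S x = 0].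

Definition invertible_op S :=
  exists2 U : {linear X -> X}, bounded_op U & cancel S U /\ cancel U S.

Definition spectrum S : set (Cplx R) :=
  [set l | ~ invertible_op (shift_op S l)].

Definition bounded_below S :=
  exists2 c : Cplx R, 0 < c & forall x, c * `|x| <= `|S x|.

Definition approx_point_spectrum S : set (Cplx R) :=
  [set l | ~ bounded_below (shift_op S l)].

Definition point_spectrum S : set (Cplx R) :=
  [set l | exists2 x, x != 0 & S x = l *: x].

Definition fredholm S := finite_dim (null_space S) /\ finite_codim (range S).

Definition fredholm_index S : int :=
  (dim (null_space S))%:Z - (codim (range S))%:Z.

Definition weyl S := fredholm S /\ fredholm_index S = 0.

Definition weyl_spectrum S : set (Cplx R) := [set l | ~ weyl (shift_op S l)].

Definition riesz S := forall m, m != 0 -> fredholm (shift_op S m).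

Definition ascent S : \bar R :=
  ereal_inf [set n%:R%:E | n in
    [set n | null_space (iter n S) = null_space (iter n.+1 S)]].

Definition descent S : \bar R :=
  ereal_inf [set n%:R%:E | n in
    [set n | range (iter n S) = range (iter n.+1 S)]].

Definition pole S l :=
  [/\ spectrum S l, (ascent (shift_op S l) < +oo)%E
    & (descent (shift_op S l) < +oo)%E].

Definition finite_rank_poles S : set (Cplx R) :=
  [set l | pole S l /\ finite_dim (null_space (shift_op S l))].

Definition isolated_approx_eigenvalues S : set (Cplx R) :=
  isolated (approx_point_spectrum S) `&` point_spectrum S.

Definition property_ZEa S :=
  spectrum S `\` weyl_spectrum S = isolated_approx_eigenvalues S.

End Operators.

(* Main.v *)
Require Import Defs.
From HB Require Import structures.
From mathcomp Require Import all_boot all_order all_algebra.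
From mathcomp Require Import all_classical all_reals all_analysis.
From mathcomp Require Import complex.
From mathcomp Require Import ring lra.

Set Implicit Arguments.
Unset Strict Implicit.
Unset Printing Implicit Defensive.

Import Order.TTheory GRing.Theory Num.Theory.
Import numFieldNormedType.Exports.

Local Open Scope classical_set_scope.
Local Open Scope ring_scope.

(** Write [1] for the identity of [X], and let [A ≈ B] mean that [A - B] has
finite rank.

Everything rests on two stability facts for a Riesz operator [Q] commuting with
a bounded operator [S].  If [S + Q] is Weyl then [S] is Weyl
([weyl_dec_perturbation]); and [S] is Browder (Fredholm of finite ascent and
descent) if and only if [S + Q] is ([browder_perturbation], applied to [Q] and
[- Q]).  Granted these, the theorem is a matter of comparing sets.  A point of
the spectrum is a pole of finite rank exactly when the shifted operator is
Browder, and such a point is always an isolated point of the approximate point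
spectrum and an eigenvalue ([finite_rank_poles_sub_Ea]).  Conversely property
(Z_Ea) forces every Weyl shift of [T] to be Browder ([property_ZEa_browder]): if
[T - l] is Weyl and not invertible, then [l] is isolated in the approximate point
spectrum, and a Weyl operator whose small shifts are injective has finite ascent
([weyl_dec_isolated_browder]).  The latter holds because, when the ascent is
infinite, [S] maps the intersection of the ranges of its powers onto itself, with
a bounded right inverse [W] and a kernel vector [x0] inside it, and then
[(1 - m *: W)^-1 x0] is an eigenvector of [S] for every small [m].

The stability facts come from one estimate.  The operators [1 - l *: Q] are
invertible modulo finite rank for every [l], so [Q] ought to be quasi-nilpotent
modulo finite rank.  This is proved without complex integration, after Rickart:
the essential resolvent is Lipschitz on discs; averaging it over square roots of
unity gives the resolvents of the powers [Q ^+ (2 ^ m)] with the same Lipschitz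
constant; so the smallness of [(s *: Q) ^+ (2 ^ m)] propagates from [s] to nearby
[t], hence from [0] everywhere ([ess_small_all]).  If [B] commutes with [Q] modulo
finite rank, then the powers of [B * Q] are essentially small too, so
[1 - (B * Q) ^+ n] is Weyl for some [n] and its factor [1 - B * Q] is Fredholm:
[B * Q] is again Riesz ([fred_rieszM]).  Finally [Q - 1] is Browder for every Riesz
[Q] ([fred_riesz_browder]), by moving along the real half-line from large [t],
where [Q - t] is invertible: the Browder points form an open and closed set.
Both perturbation results then follow by factoring out an invertible operator.

The functional analysis underneath consists of the Hahn-Banach theorem for
complex scalars (giving bounded projections onto finite-dimensional subspaces),
the open mapping theorem (giving a bounded generalized inverse of a Fredholm
operator), the Neumann series, and the linear algebra identifying the operators
of Fredholm index zero with the sums of an invertible and a finite-rank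
operator. *)

Reserved Notation "A ≈ B" (at level 70).

(** * Real-valued norms and the ring of bounded operators *)

Section RealNorm.
Variables (R : realType) (X : normedModType (Cplx R)).
Implicit Types (x y : X) (a b : Cplx R).

(** The norm of the library takes values in [R[i]], whose order is partial; its
real part allows arithmetic in the ordered field [R]. *)
Definition nrm x : R := complex.Re (`|x| : R[i]).

Definition cabs a : R := complex.Re (`|a| : R[i]).

Lemma nrmE x : `|x| = (nrm x)%:C%C :> Cplx R.
Proof. by rewrite [RHS]RRe_real // ger0_real. Qed.

Lemma cabsE a : `|a| = (cabs a)%:C%C :> Cplx R.
Proof. by rewrite [RHS]RRe_real // ger0_real. Qed.

Lemma nrm_ge0 x : 0 <= nrm x.
Proof. by rewrite -(ler0c (nrm x)) -[X in 0 <= X]nrmE. Qed.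

Lemma cabs_ge0 a : 0 <= cabs a.
Proof. by rewrite -(ler0c (cabs a)) -[X in 0 <= X]cabsE. Qed.

Lemma nrm0 : nrm 0 = 0.
Proof. by rewrite /nrm normr0. Qed.

Lemma nrmN x : nrm (- x) = nrm x.
Proof. by rewrite /nrm normrN. Qed.

Lemma nrmB x y : nrm (x - y) = nrm (y - x).
Proof. by rewrite -nrmN opprB. Qed.

Lemma nrm_eq0 x : nrm x = 0 -> x = 0.
Proof. by move=> x0; apply/eqP; rewrite -normr_eq0 nrmE x0. Qed.

Lemma nrm_gt0 x : x != 0 -> 0 < nrm x.
Proof.
move=> x0; rewrite lt_def nrm_ge0 andbT.
by apply: contra x0 => /eqP/nrm_eq0/eqP.
Qed.

Lemma nrmD x y : nrm (x + y) <= nrm x + nrm y.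
Proof.
rewrite -(lecR (nrm (x + y))) rmorphD /=.
by have := ler_normD x y; rewrite !nrmE.
Qed.

Lemma nrm_tri x y z : nrm (x - z) <= nrm (x - y) + nrm (y - z).
Proof. by rewrite (le_trans _ (nrmD _ _))// addrA subrK. Qed.

Lemma nrmZ a x : nrm (a *: x) = cabs a * nrm x.
Proof.
apply: complexI; rewrite [RHS]rmorphM /=.
by have := normrZ a x; rewrite !nrmE cabsE.
Qed.

Lemma cabsM a b : cabs (a * b) = cabs a * cabs b.
Proof.
by apply: complexI; rewrite [RHS]rmorphM /=; have := normrM a b; rewrite !cabsE.
Qed.

Lemma cabs1 : cabs 1 = 1.
Proof. by rewrite /cabs normr1. Qed.

Lemma cabs0 : cabs 0 = 0.
Proof. by rewrite /cabs normr0. Qed.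

Lemma cabsN a : cabs (- a) = cabs a.
Proof. by rewrite /cabs normrN. Qed.

Lemma cabsB a b : cabs (a - b) = cabs (b - a).
Proof. by rewrite -cabsN opprB. Qed.

Lemma cabsX a n : cabs (a ^+ n) = cabs a ^+ n.
Proof. by elim: n => [|n IH]; rewrite ?expr0 ?cabs1// !exprS cabsM IH. Qed.

Lemma cabsD a b : cabs (a + b) <= cabs a + cabs b.
Proof.
rewrite -(lecR (cabs (a + b))) rmorphD /=.
by have := ler_normD a b; rewrite !cabsE.
Qed.

Lemma cabs_eq0 a : cabs a = 0 -> a = 0.
Proof. by move=> x0; apply/eqP; rewrite -normr_eq0 cabsE x0. Qed.

Lemma cabs_gt0 a : a != 0 -> 0 < cabs a.
Proof.
move=> x0; rewrite lt_def cabs_ge0 andbT.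
by apply: contra x0 => /eqP/cabs_eq0/eqP.
Qed.

Lemma cabsV a : cabs a^-1 = (cabs a)^-1.
Proof.
have [->|a0] := eqVneq a 0; first by rewrite invr0 cabs0 invr0.
have ca0 := lt0r_neq0 (cabs_gt0 a0).
by apply: (mulfI ca0); rewrite -cabsM divff// divff// cabs1.
Qed.

Lemma cabs_real (r : R) : cabs (r%:C%C) = `|r|.
Proof. by rewrite /cabs normc_def /= expr0n addr0 sqrtr_sqr. Qed.

Lemma bounded_opP (S : X -> X) :
  (exists M : Cplx R, forall x, `|S x| <= M * `|x|) <->
  (exists2 M : R, 0 <= M & forall x, nrm (S x) <= M * nrm x).
Proof.
split=> [[M SM]|[M M0 SM]]; last first.
  exists (M%:C%C) => x; rewrite !nrmE -(rmorphM (real_complex R)).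
  by rewrite lecR.
exists (cabs M) => [|x]; first exact: cabs_ge0.
have := SM x; rewrite !nrmE => SMx.
have : `|(nrm (S x))%:C%C : Cplx R| <= `|M * (nrm x)%:C%C : Cplx R|.
  have S0 : 0 <= (nrm (S x))%:C%C :> Cplx R by rewrite ler0c nrm_ge0.
  by rewrite !ger0_norm ?(le_trans S0 SMx).
rewrite normrM !cabsE -(rmorphM (real_complex R)) lecR !cabs_real.
by rewrite !ger0_norm ?nrm_ge0.
Qed.

End RealNorm.

Section Completeness.
Variables (R : realType) (X : completeNormedModType (Cplx R)).

(** Completeness with an explicit modulus [e], which also bounds the distance to
the limit. *)
Lemma nrm_complete (u : nat -> X) (e : nat -> R) :
  (forall k m, (k <= m)%N -> nrm (u m - u k) <= e k) ->
  (forall d, 0 < d -> exists k, e k < d) ->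
  exists l, forall k, nrm (l - u k) <= e k.
Proof.
move=> ue e0.
have cu : cauchy (u @ \oo).
  apply/cauchy_exP => d d0.
  have dE : d = (complex.Re (d : R[i]))%:C%C by rewrite RRe_real // gtr0_real.
  move: d0; rewrite dE -/(0 < _) => d0.
  have {}d0 : 0 < complex.Re (d : R[i]) by rewrite -ltcR.
  have [k ek] := e0 _ d0.
  exists (u k); exists k => // m /= km.
  by rewrite -ball_normE /= nrmE ltcR nrmB (le_lt_trans _ ek)// ue.
have [l ul] : exists l : X, u @ \oo --> l by apply/cvg_ex; exact: (cauchy_cvg (u @ \oo)).
exists l => k; apply/ler_addgt0Pr => d d0.
have /cvgrPdist_lt/(_ (d%:C%C)) := ul; rewrite ltcR => /(_ d0)[m _ um].
have := um (maxn m k) (leq_maxl _ _); rewrite nrmE ltcR => um'.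
rewrite (le_trans (nrm_tri _ (u (maxn m k)) _))// addrC.
by rewrite lerD ?ue ?leq_maxr// ltW.
Qed.

End Completeness.

Section BoundedOperators.
Variables (R : realType) (X : completeNormedModType (Cplx R)).

Record bop := Bop { bop_lin :> {linear X -> X}; _ : bounded_op bop_lin }.

Lemma bop_bounded (A : bop) :
  exists2 M : R, 0 <= M & forall x, nrm (A x) <= M * nrm x.
Proof. by case: A => A /= /bounded_opP. Qed.

Lemma bopP (A B : bop) : (forall x, A x = B x) -> A = B.
Proof.
case: A B => [A bA] [B bB] /= AB.
have {}AB : A = B.
  case: A B AB {bA bB} => [A cA] [B cB] /= /funext AB; rewrite AB in cA *.
  congr GRing.Linear.Pack.
  case: cA cB => [[a1] [a2]] [[b1] [b2]].
  congr GRing.Linear.Class.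
    by congr GRing.isNmodMorphism.Axioms_; exact: Prop_irrelevance.
  by congr GRing.isScalable.Axioms_; exact: Prop_irrelevance.
by rewrite AB in bA *; congr Bop; exact: Prop_irrelevance.
Qed.

HB.instance Definition _ := gen_eqMixin bop.
HB.instance Definition _ := gen_choiceMixin bop.

Implicit Types (A B C : bop) (x y : X) (a b : Cplx R).

Fact bounded_op0 : bounded_op (\0 : {linear X -> X}).
Proof. by apply/bounded_opP; exists 0 => // x; rewrite mul0r nrm0. Qed.

Fact bounded_op1 : bounded_op (idfun : {linear X -> X}).
Proof. by apply/bounded_opP; exists 1 => // x; rewrite mul1r. Qed.

Fact bounded_opD A B : bounded_op (A \+ B : {linear X -> X}).
Proof.
have [a a0 Aa] := bop_bounded A; have [b b0 Bb] := bop_bounded B.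
apply/bounded_opP; exists (a + b) => [|x]; first exact: addr_ge0.
by rewrite mulrDl (le_trans (nrmD _ _))// lerD.
Qed.

Fact bounded_opN A : bounded_op (\- A : {linear X -> X}).
Proof.
have [a a0 Aa] := bop_bounded A.
by apply/bounded_opP; exists a => // x; rewrite nrmN.
Qed.

Fact bounded_opM A B : bounded_op (A \o B : {linear X -> X}).
Proof.
have [a a0 Aa] := bop_bounded A; have [b b0 Bb] := bop_bounded B.
apply/bounded_opP; exists (a * b) => [|x]; first exact: mulr_ge0.
by rewrite (le_trans (Aa _))// -mulrA ler_wpM2l.
Qed.

Fact bounded_opZ k A : bounded_op (k \*: A : {linear X -> X}).
Proof.
have [a a0 Aa] := bop_bounded A.
apply/bounded_opP; exists (cabs k * a) => [|x].
  by rewrite mulr_ge0// cabs_ge0.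
by rewrite /= nrmZ -mulrA ler_wpM2l// cabs_ge0.
Qed.

(** The operations are locked so that unification does not unfold [(A + B) x]
into a sum of vectors. *)
Fact bop_key : unit. Proof. exact: tt. Qed.
Definition bop_zero := locked_with bop_key (Bop bounded_op0).
Definition bop_one := locked_with bop_key (Bop bounded_op1).
Definition bop_add := locked_with bop_key (fun A B => Bop (bounded_opD A B)).
Definition bop_opp := locked_with bop_key (fun A => Bop (bounded_opN A)).
Definition bop_mul := locked_with bop_key (fun A B => Bop (bounded_opM A B)).
Definition bop_scale :=
  locked_with bop_key (fun a A => Bop (bounded_opZ a A)).

Fact bop_zeroE x : bop_zero x = 0. Proof. by rewrite [bop_zero]unlock. Qed.
Fact bop_oneE x : bop_one x = x. Proof. by rewrite [bop_one]unlock. Qed.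
Fact bop_addE A B x : bop_add A B x = A x + B x.
Proof. by rewrite [bop_add]unlock. Qed.
Fact bop_oppE A x : bop_opp A x = - A x. Proof. by rewrite [bop_opp]unlock. Qed.
Fact bop_mulE A B x : bop_mul A B x = A (B x).
Proof. by rewrite [bop_mul]unlock. Qed.
Fact bop_scaleE a A x : bop_scale a A x = a *: A x.
Proof. by rewrite [bop_scale]unlock. Qed.
Let opsE :=
  (bop_zeroE, bop_oneE, bop_addE, bop_oppE, bop_mulE, bop_scaleE).

Fact bop_addA : associative bop_add.
Proof. by move=> A B C; apply: bopP => x; rewrite !opsE addrA. Qed.
Fact bop_addC : commutative bop_add.
Proof. by move=> A B; apply: bopP => x; rewrite !opsE addrC. Qed.
Fact bop_add0 : left_id bop_zero bop_add.
Proof. by move=> A; apply: bopP => x; rewrite !opsE add0r. Qed.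
Fact bop_addN : left_inverse bop_zero bop_opp bop_add.
Proof. by move=> A; apply: bopP => x; rewrite !opsE addNr. Qed.

HB.instance Definition _ :=
  GRing.isZmodule.Build bop bop_addA bop_addC bop_add0 bop_addN.

Fact bop_mulA : associative bop_mul.
Proof. by move=> A B C; apply: bopP => x; rewrite !opsE. Qed.
Fact bop_mul1 : left_id bop_one bop_mul.
Proof. by move=> A; apply: bopP => x; rewrite !opsE. Qed.
Fact bop_mulr1 : right_id bop_one bop_mul.
Proof. by move=> A; apply: bopP => x; rewrite !opsE. Qed.
Fact bop_mulDl : left_distributive bop_mul +%R.
Proof. by move=> A B C; apply: bopP => x; rewrite !opsE. Qed.
Fact bop_mulDr : right_distributive bop_mul +%R.
Proof. by move=> A B C; apply: bopP => x; rewrite !opsE raddfD. Qed.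

HB.instance Definition _ := GRing.Zmodule_isPzRing.Build bop
  bop_mulA bop_mul1 bop_mulr1 bop_mulDl bop_mulDr.

Fact bop_scaleA a b A : bop_scale a (bop_scale b A) = bop_scale (a * b) A.
Proof. by apply: bopP => x; rewrite !opsE scalerA. Qed.
Fact bop_scale1 : left_id 1 bop_scale.
Proof. by move=> A; apply: bopP => x; rewrite !opsE scale1r. Qed.
Fact bop_scaleDr : right_distributive bop_scale +%R.
Proof. by move=> a A B; apply: bopP => x; rewrite !opsE scalerDr. Qed.
Fact bop_scaleDl A : {morph (fun a => bop_scale a A) : a b / a + b}.
Proof. by move=> a b; apply: bopP => x; rewrite !opsE scalerDl. Qed.

HB.instance Definition _ := GRing.Zmodule_isLmodule.Build (Cplx R) bop
  bop_scaleA bop_scale1 bop_scaleDr bop_scaleDl.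

Lemma bop0E x : (0 : bop) x = 0. Proof. exact: bop_zeroE. Qed.
Lemma bop1E x : (1 : bop) x = x. Proof. exact: bop_oneE. Qed.
Lemma bopDE A B x : (A + B) x = A x + B x. Proof. exact: bop_addE. Qed.
Lemma bopNE A x : (- A) x = - A x. Proof. exact: bop_oppE. Qed.
Lemma bopBE A B x : (A - B) x = A x - B x. Proof. by rewrite bopDE bopNE. Qed.
Lemma bopME A B x : (A * B) x = A (B x). Proof. exact: bop_mulE. Qed.
Lemma bopZE a A x : (a *: A) x = a *: A x. Proof. exact: bop_scaleE. Qed.

Definition bopE := (bop0E, bop1E, bopDE, bopNE, bopME, bopZE).

Lemma bopr0 A : A 0 = 0. Proof. exact: raddf0. Qed.
Lemma boprD A x y : A (x + y) = A x + A y. Proof. exact: raddfD. Qed.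
Lemma boprN A x : A (- x) = - A x. Proof. exact: raddfN. Qed.
Lemma boprB A x y : A (x - y) = A x - A y. Proof. exact: raddfB. Qed.
Lemma boprZ A a x : A (a *: x) = a *: A x. Proof. exact: linearZ. Qed.
Lemma bopr_sum A (I : Type) (r : seq I) (P : pred I) (F : I -> X) :
  A (\sum_(i <- r | P i) F i) = \sum_(i <- r | P i) A (F i).
Proof. exact: raddf_sum. Qed.

Lemma bopXE A n x : (A ^+ n) x = iter n A x.
Proof. by elim: n x => [|n IH] x; rewrite ?bop1E// exprS bopME IH. Qed.

Lemma bop_scalerAl a A B : a *: (A * B) = (a *: A) * B.
Proof. by apply: bopP => x; rewrite !bopE. Qed.

Lemma bop_scalerAr a A B : a *: (A * B) = A * (a *: B).
Proof. by apply: bopP => x; rewrite !bopE boprZ. Qed.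

Lemma bop_exprZ a A n : (a *: A) ^+ n = a ^+ n *: A ^+ n.
Proof.
elim: n => [|n IH]; first by rewrite !expr0 scale1r.
by rewrite !exprS IH -bop_scalerAl -bop_scalerAr scalerA.
Qed.

End BoundedOperators.

(** * Bounded functionals *)

Section HahnBanach.
Variables (R : realType) (X : normedModType (Cplx R)).
Implicit Types (p q : X -> R) (x y : X).

Definition sublinear q := (forall x y, q (x + y) <= q x + q y) /\
  (forall (t : R) x, 0 <= t -> q (t%:C%C *: x) <= t * q x).

Lemma sublinear0 q : sublinear q -> q 0 = 0.
Proof.
move=> [qD qZ]; have := qZ 0 0 (lexx _); have := qD 0 0.
rewrite addr0 scaler0; lra.
Qed.

Lemma sublinearZ q t x : sublinear q -> 0 <= t -> q (t%:C%C *: x) = t * q x.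
Proof.
move=> sq t0; apply/eqP; rewrite eq_le sq.2//=.
have [->|tN0] := eqVneq t 0.
  by rewrite [X in X *: _]rmorph0 scale0r mul0r sublinear0.
have t1 : 0 < t by rewrite lt_def tN0.
have := sq.2 t^-1 (t%:C%C *: x); rewrite invr_ge0 => /(_ t0).
rewrite scalerA -(rmorphM (real_complex R)) mulVf//= scale1r.
by rewrite -ler_pdivlMl.
Qed.

Lemma sublinear_nrm : sublinear (@nrm R X).
Proof.
split=> [|t x t0]; first exact: nrmD.
by rewrite nrmZ cabs_real ger0_norm.
Qed.

(** Lowers [q] so that its value at [- y] drops to [- q y], the first step towards
linearity; a sublinear functional fixed by every such step is linear. *)
Definition straighten q y x :=
  inf [set q (x + t%:C%C *: y) - t * q y | t in [set t | 0 <= t]].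

Lemma straighten_lb q y x : sublinear q ->
  lbound [set q (x + t%:C%C *: y) - t * q y | t in [set t | 0 <= t]]
    (- q (- x)).
Proof.
move=> sq _ [t /= t0 <-]; rewrite -sublinearZ//.
have := sq.1 (x + t%:C%C *: y) (- x); rewrite [x + _]addrC addrK; lra.
Qed.

Lemma straighten_le q y x t : sublinear q -> 0 <= t ->
  straighten q y x <= q (x + t%:C%C *: y) - t * q y.
Proof.
move=> sq t0; apply: ge_inf; last by exists t.
by exists (- q (- x)); exact: straighten_lb.
Qed.

Lemma straighten_ge q y x (c : R) :
  (forall t, 0 <= t -> c <= q (x + t%:C%C *: y) - t * q y) ->
  c <= straighten q y x.
Proof.
move=> cq; apply: lb_le_inf; last by move=> _ [t /= t0 <-]; exact: cq.
by exists (q (x + 0%:C%C *: y) - 0 * q y), 0 => /=.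
Qed.

Lemma straighten_id q y x : sublinear q -> straighten q y x <= q x.
Proof.
move=> sq; have := straighten_le y x sq (lexx 0).
by rewrite [X in X *: _]rmorph0 scale0r addr0 mul0r subr0.
Qed.

Lemma straightenN q y : sublinear q -> straighten q y (- y) <= - q y.
Proof.
move=> sq; have := straighten_le y (- y) sq ler01.
by rewrite [X in X *: _]rmorph1 scale1r addNr sublinear0// mul1r add0r.
Qed.

Lemma sublinear_straighten q y : sublinear q -> sublinear (straighten q y).
Proof.
move=> sq; split=> [u v|s x s0].
  have H t : 0 <= t ->
      straighten q y (u + v) - (q (v + t%:C%C *: y) - t * q y)
      <= straighten q y u.
    move=> t0; apply: straighten_ge => r r0.
    have := straighten_le y (u + v) sq (addr_ge0 r0 t0).
    rewrite [X in X *: _]rmorphD scalerDl addrACA /=.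
    have := sq.1 (u + r%:C%C *: y) (v + t%:C%C *: y); lra.
  suff : straighten q y (u + v) - straighten q y u <= straighten q y v by lra.
  by apply: straighten_ge => t t0; have := H t t0; lra.
have [->|sN0] := eqVneq s 0.
  rewrite [X in X *: _]rmorph0 scale0r mul0r.
  by have := straighten_id y 0 sq; rewrite (sublinear0 sq).
have s1 : 0 < s by rewrite lt_def sN0.
rewrite -ler_pdivrMl//; apply: straighten_ge => t t0.
rewrite ler_pdivrMl// mulrBr mulrA -sublinearZ// scalerDr scalerA.
rewrite -(rmorphM (real_complex R)).
by apply: straighten_le => //; exact: mulr_ge0.
Qed.

Definition real_linear q := (forall x y, q (x + y) = q x + q y) /\
  (forall (t : R) x, q (t%:C%C *: x) = t * q x).

(** A minimal sublinear functional equals each of its straightenings, hence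
is linear; minimal ones exist below every [p] by Zorn's lemma, a chain being
bounded below by its pointwise infimum. *)
Lemma sublinear_minorant p : sublinear p ->
  exists2 q, real_linear q & forall x, q x <= p x.
Proof.
move=> sp.
pose T := {q | sublinear q /\ forall x, q x <= p x}.
pose below (s t : T) := `[< forall x, sval t x <= sval s x >].
have [|||A totA|[q [sq qp]] qmin] := @Zorn T below.
- by move=> t; apply/asboolP.
- move=> r s t /asboolP rs /asboolP st; apply/asboolP => x.
  exact: le_trans (st x) (rs x).
- move=> [s Ps] [t Pt] /asboolP/= st /asboolP/= ts.
  by apply: eq_exist; apply/funext => x; apply/eqP; rewrite eq_le st ts.
- have [[a Aa]|A0] := pselect (exists a, A a); last first.
    exists (exist _ p (conj sp (fun x => lexx _))) => s As.
    by exfalso; apply: A0; exists s.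
  pose E x := [set sval s x | s in A].
  pose m x := inf (E x).
  have Elb x : lbound (E x) (- p (- x)).
    move=> _ [[s [ss sp']] As <-] /=.
    have := ss.1 x (- x); rewrite subrr sublinear0//; have := sp' (- x); lra.
  have mle s x : A s -> m x <= sval s x.
    move=> As; apply: ge_inf; last by exists s.
    by exists (- p (- x)); exact: Elb.
  have mge x c : (forall s, A s -> c <= sval s x) -> c <= m x.
    move=> cs; apply: lb_le_inf; first by exists (sval a x), a.
    by move=> _ [s As <-]; exact: cs.
  have sm : sublinear m.
    split=> [x y|t x t0].
      have H s : A s -> m (x + y) - sval s y <= m x.
        move=> As; apply: mge => r Ar.
        have [/asboolP rs|/asboolP sr] := totA _ _ Ar As.
          have := mle _ (x + y) As; have := rs x.
          by have := (svalP s).1.1 x y; lra.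
        have := mle _ (x + y) Ar; have := sr y.
        by have := (svalP r).1.1 x y; lra.
      suff : m (x + y) - m x <= m y by lra.
      by apply: mge => s /H; lra.
    have [->|tN0] := eqVneq t 0.
      rewrite [X in X *: _]rmorph0 scale0r mul0r (le_trans (mle a 0 Aa))//.
      by rewrite (sublinear0 (svalP a).1).
    have t1 : 0 < t by rewrite lt_def tN0.
    rewrite -ler_pdivrMl//; apply: mge => s As; rewrite ler_pdivrMl//.
    by rewrite (le_trans (mle s _ As))// (svalP s).1.2.
  have mp x : m x <= p x by rewrite (le_trans (mle a x Aa))// (svalP a).2.
  exists (exist _ m (conj sm mp)) => s As.
  by apply/asboolP => x /=; exact: mle.
exists q => //.
have qE y : straighten q y = q.
  have Ps : sublinear (straighten q y) /\ forall x, straighten q y x <= p x.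
    split; first exact: sublinear_straighten.
    by move=> x; exact: le_trans (straighten_id _ _ sq) (qp x).
  apply: (congr1 sval (qmin (exist _ _ Ps) _)).
  by apply/asboolP => x /=; exact: straighten_id.
have qN y : q (- y) = - q y.
  apply/eqP; rewrite eq_le; have := straightenN y sq; rewrite qE => -> /=.
  by have := sq.1 y (- y); rewrite subrr sublinear0//; lra.
split=> [x y|t x].
  apply/eqP; rewrite eq_le sq.1 /=.
  by have := sq.1 (- x) (- y); rewrite -opprD !qN; lra.
have [t0|t0] := leP 0 t; first exact: sublinearZ.
have /sublinearZ : 0 <= - t by lra.
move=> /(_ _ x sq).
by rewrite [X in X *: _]rmorphN scaleNr qN mulNr => /oppr_inj.
Qed.

Definition bounded_functional (g : X -> Cplx R) :=
  scalar g /\ exists M : R, forall x, cabs (g x) <= M * nrm x.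

(** Straightening the norm along [x0] before taking a linear minorant [f] forces
[f x0] to be the norm of [x0]; and [f] is the real part of the complex functional
[x |-> f x - 'i f ('i x)]. *)
Lemma hahn_banach x0 : x0 != 0 ->
  exists2 g, bounded_functional g & g x0 = 1.
Proof.
move=> x00.
have snrm := sublinear_nrm.
have [f [fD fZ] fle] := sublinear_minorant (sublinear_straighten x0 snrm).
have fN x : f (- x) = - f x.
  by have := fZ (-1) x; rewrite [X in X *: _]rmorphN1 scaleN1r mulN1r.
have fnrm x : f x <= nrm x by exact: le_trans (fle _) (straighten_id _ _ snrm).
have fx0 : 0 < f x0.
  have := le_trans (fle _) (straightenN x0 snrm); rewrite fN lerN2.
  exact/lt_le_trans/nrm_gt0.
have fabs x : `|f x| <= nrm x.
  by have := fnrm (- x); rewrite fN nrmN ler_norml fnrm andbT lerNl.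
pose F x : Cplx R := (f x)%:C%C - ('i : R[i])%C * (f (('i%C : Cplx R) *: x))%:C%C.
have ii : ('i%C * 'i%C : R[i]) = -1 by rewrite -expr2 sqr_i.
have scF : scalar F.
  move=> [a b] u v; rewrite /F.
  have dec (w : X) : ((a +i* b)%C : Cplx R) *: w =
      a%:C%C *: w + b%:C%C *: (('i%C : Cplx R) *: w).
    rewrite scalerA -scalerDl; congr (_ *: w).
    by rewrite [LHS]complexE /= mulrC.
  have decI (w : X) : ('i%C : Cplx R) *: (((a +i* b)%C : Cplx R) *: w) =
      a%:C%C *: (('i%C : Cplx R) *: w) - b%:C%C *: w.
    rewrite !scalerA -scalerBl; congr (_ *: w).
    by apply/eqP; rewrite eq_complex /=; apply/andP; split; apply/eqP; ring.
  rewrite scalerDr decI dec !fD fN !fZ.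
  by apply/eqP; rewrite eq_complex /=; apply/andP; split; apply/eqP; ring.
have ReF x : complex.Re (F x : R[i]) = f x by rewrite /F /=; ring.
have Fx0 : F x0 != 0.
  by apply/eqP => F0; have := ReF x0; rewrite F0 /= => f0; rewrite -f0 ltxx in fx0.
exists (fun x => (F x0)^-1 * F x); last exact: mulVf.
split=> [a u v|]; first by rewrite scF; ring.
exists ((cabs (F x0))^-1 * 2) => x.
rewrite cabsM cabsV -mulrA ler_wpM2l ?invr_ge0 ?cabs_ge0//.
rewrite /F (le_trans (cabsD _ _))// cabsN cabsM !cabs_real.
have -> : cabs ('i%C : Cplx R) = 1.
  by rewrite /cabs normc_def /= expr0n expr1n add0r sqrtr1.
rewrite mul1r mulr_natl mulr2n lerD// (le_trans (fabs _))//.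
rewrite nrmZ.
have -> : cabs ('i%C : Cplx R) = 1.
  by rewrite /cabs normc_def /= expr0n expr1n add0r sqrtr1.
by rewrite mul1r.
Qed.

(** Gram-Schmidt with functionals in place of inner products: to separate [e i]
from [e j] and from earlier vectors, correct a functional vanishing on the earlier
vectors by a multiple of one that also takes the value 1 at [e j]. *)
Lemma hahn_banach_family (I : finType) (e : I -> X) :
  (forall c : I -> Cplx R, \sum_i c i *: e i = 0 -> forall i, c i = 0) ->
  exists f : I -> X -> Cplx R, (forall i, bounded_functional (f i)) /\
    forall i j, f i (e j) = (i == j)%:R.
Proof.
move=> indep.
(* The induction needs arbitrary combinations of the family, as correcting a
   vector by a multiple of [e j] leaves the family. *)
suff H (l : seq I) : uniq l -> forall a : I -> Cplx R,
    (exists2 i, i \notin l & a i != 0) ->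
    exists g, [/\ bounded_functional g, forall j, j \in l -> g (e j) = 0
      & g (\sum_i a i *: e i) = 1].
  have {}H i : {g | bounded_functional g /\ forall j, g (e j) = (i == j)%:R}.
    apply: cid; have [||g [bg g0 g1]] := H (rem i (enum I)) _ (fun j => (i == j)%:R).
    - by rewrite rem_uniq// enum_uniq.
    - by exists i; rewrite ?eqxx ?oner_eq0// mem_rem_uniq ?enum_uniq// !inE eqxx.
    - exists g; split=> // j; have [<-|ij] := eqVneq i j; last first.
        by apply: g0; rewrite mem_rem_uniq ?enum_uniq// !inE eq_sym ij mem_enum.
      rewrite (bigD1 i)//= eqxx scale1r big1 ?addr0// in g1.
      by move=> k; rewrite eq_sym => /negbTE->; rewrite scale0r.
  by exists (fun i => sval (H i)); split=> i; case: (svalP (H i)).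
elim: l => [_ a [i _ ai]|j l IH /= /andP[jl ul] a [i + ai]].
  have [|g bg g1] := @hahn_banach (\sum_i a i *: e i); last by exists g.
  by apply: contra ai => /eqP /indep ->.
rewrite inE negb_or => /andP[ij il].
have [|g1 [bg1 g10 g11]] := IH ul (fun k => (j == k)%:R).
  by exists j => //; rewrite eqxx oner_eq0.
have {}g11 : g1 (e j) = 1.
  rewrite (bigD1 j)//= eqxx scale1r big1 ?addr0// in g11.
  by move=> k; rewrite eq_sym => /negbTE->; rewrite scale0r.
set x := \sum_i a i *: e i.
have [|g2 [bg2 g20 g21]] := IH ul (fun k => a k - g1 x * (j == k)%:R).
  by exists i => //; rewrite [j == i]eq_sym (negbTE ij) mulr0 subr0.
have {}g21 : g2 (x - g1 x *: e j) = 1.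
  rewrite -g21; congr g2.
  under [in RHS]eq_bigr do rewrite scalerBl.
  rewrite sumrB; congr (_ - _).
  rewrite (bigD1 j)//= eqxx mulr1 big1 ?addr0// => k.
  by rewrite eq_sym => /negbTE->; rewrite mulr0 scale0r.
case: bg1 => s1 [M1 bM1]; case: bg2 => s2 [M2 bM2].
have sB g u v c : scalar g -> g (u - c *: v) = g u - c * g v.
  by move=> sg; rewrite [u - _]addrC -scaleNr sg mulNr addrC.
exists (fun z => g2 z - g2 (e j) * g1 z); split.
- split=> [c u v|]; first by rewrite s1 s2; ring.
  exists (M2 + cabs (g2 (e j)) * M1) => z.
  rewrite (le_trans (cabsD _ _))// cabsN cabsM mulrDl lerD// -mulrA.
  by rewrite ler_wpM2l// cabs_ge0.
- move=> k; rewrite inE => /orP[/eqP->|kl]; first by rewrite g11 mulr1 subrr.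
  by rewrite g10// g20// mulr0 subr0.
- by rewrite -g21 sB// mulrC.
Qed.

End HahnBanach.

(** * Neumann series and open mappings *)

Section Geometric.
Variable R : realType.
Implicit Types q a b : R.

Lemma geometric_small q d : 0 <= q -> q < 1 -> 0 < d -> exists k, q ^+ k < d.
Proof.
move=> q0 q1 d0; have /cvgrPdist_lt/(_ d d0)[k _ /(_ k (leqnn k))] :
    (q ^+ n @[n --> \oo] --> (0 : R)).
  by apply: cvg_expr; rewrite ger0_norm.
by rewrite sub0r normrN ger0_norm ?exprn_ge0// => ?; exists k.
Qed.

Lemma le_geometric0 q a b : 0 <= q -> q < 1 -> (forall k, a <= q ^+ k * b) ->
  a <= 0.
Proof.
move=> q0 q1 aqb; rewrite leNgt; apply/negP => a0.
have b0 : 0 < b.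
  by have := lt_le_trans a0 (aqb 0); rewrite expr0 mul1r.
have [k] := geometric_small q0 q1 (divr_gt0 a0 b0).
by rewrite ltr_pdivlMr// ltNge aqb.
Qed.

End Geometric.

Section Banach.
Variables (R : realType) (X : completeNormedModType (Cplx R)).
Local Notation bop := (bop X).
Implicit Types (A B : bop) (x y : X).

Lemma geometric_increments (u : nat -> X) (r : nat -> R) q :
  0 <= q -> q < 1 -> (forall k, nrm (u k.+1 - u k) <= r k) ->
  (forall k, r k.+1 <= q * r k) ->
  exists l, forall k, nrm (l - u k) <= r k / (1 - q).
Proof.
move=> q0 q1 ur rq; have q1' : 0 < 1 - q by lra.
have r0 k : 0 <= r k by exact: le_trans (nrm_ge0 _) (ur k).
apply: nrm_complete => [k m|d d0].
  move=> /subnKC <-; apply: (@le_trans _ _ ((r k - r (k + (m - k))%N) / (1 - q))).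
    elim: (m - k)%N => [|n IH]; first by rewrite addn0 !subrr nrm0 mul0r.
    rewrite addnS (le_trans (nrm_tri _ (u (k + n)%N) _))//.
    have := lerD (ur (k + n)%N) IH => /le_trans; apply.
    rewrite -(ler_pM2r q1') mulrDl !divfK ?gt_eqF//.
    by have := rq (k + n)%N; lra.
  by rewrite ler_pM2r ?invr_gt0// lerBlDr lerDl.
have rk k : r k <= q ^+ k * r 0.
  elim: k => [|k IH]; first by rewrite expr0 mul1r.
  by rewrite (le_trans (rq k))// exprS -mulrA ler_wpM2l.
have dpos : 0 < d * (1 - q) / (r 0 + 1) by rewrite divr_gt0 ?mulr_gt0// ltr_wpDl.
have [k] := geometric_small q0 q1 dpos.
rewrite ltr_pdivlMr ?ltr_wpDl// => h; exists k.
rewrite ltr_pdivrMr// (le_lt_trans (rk k))// (le_lt_trans _ h)//.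
by rewrite ler_wpM2l ?exprn_ge0// lerDl.
Qed.

Definition op_le A (c : R) := forall x, nrm (A x) <= c * nrm x.

Lemma op_le_ex A : exists2 c, 0 < c & op_le A c.
Proof.
have [c c0 Ac] := bop_bounded A; exists (c + 1) => [|x]; first by lra.
by rewrite (le_trans (Ac x))// ler_wpM2r ?nrm_ge0//; lra.
Qed.

Lemma op_le_weaken A c d : op_le A c -> c <= d -> op_le A d.
Proof.
by move=> Ac cd x; rewrite (le_trans (Ac x))// ler_wpM2r// nrm_ge0.
Qed.

Lemma op_leD A B c d : op_le A c -> op_le B d -> op_le (A + B) (c + d).
Proof.
by move=> Ac Bd x; rewrite bopE (le_trans (nrmD _ _))// mulrDl lerD.
Qed.

Lemma op_leN A c : op_le A c -> op_le (- A) c.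
Proof. by move=> Ac x; rewrite bopE nrmN. Qed.

Lemma op_leM A B c d : 0 <= c -> op_le A c -> op_le B d -> op_le (A * B) (c * d).
Proof.
by move=> c0 Ac Bd x; rewrite bopE (le_trans (Ac _))// -mulrA ler_wpM2l.
Qed.

Lemma op_leZ a A c : op_le A c -> op_le (a *: A) (cabs a * c).
Proof.
by move=> Ac x; rewrite bopE nrmZ -mulrA ler_wpM2l// cabs_ge0.
Qed.

Lemma op_le1 : op_le 1 1.
Proof. by move=> x; rewrite bop1E mul1r. Qed.

Lemma op_le0 : op_le 0 0.
Proof. by move=> x; rewrite bopE nrm0 mul0r. Qed.

Lemma op_leX A c n : 0 <= c -> op_le A c -> op_le (A ^+ n) (c ^+ n).
Proof.
move=> c0 Ac; elim: n => [|n IH]; first by rewrite !expr0; exact: op_le1.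
by rewrite !exprS; exact: op_leM.
Qed.

Lemma mk_bop (f : X -> X) (c : R) :
  (forall a x y, f (a *: x + y) = a *: f x + f y) ->
  (forall x, nrm (f x) <= c * nrm x) -> {A : bop | forall x, A x = f x}.
Proof.
move=> lf fc; pose F : {linear X -> X} := HB.pack f (GRing.isLinear.Build _ _ _ _ f lf).
have bF : bounded_op F.
  apply/bounded_opP; exists (`|c|) => [|x]; first exact: normr_ge0.
  by rewrite (le_trans (fc x))// ler_wpM2r ?nrm_ge0// ler_norm.
by exists (Bop bF).
Qed.

Definition inverse A B := A * B = 1 /\ B * A = 1.

Definition invertible A := exists B, inverse A B.

(** Linearity of the inverse comes for free from injectivity, so a solution of
[A x = y] with a bound linear in [y] is all that has to be constructed. *)
Lemma inverse_bij A (c : R) : (forall x, A x = 0 -> x = 0) ->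
  (forall y, exists2 x, A x = y & nrm x <= c * nrm y) ->
  exists2 B, inverse A B & op_le B c.
Proof.
move=> injA surjA.
have /choice[f fP] : forall y, exists x, A x = y /\ nrm x <= c * nrm y.
  by move=> y; have [x] := surjA y; exists x.
have Af y := (fP y).1; have fc y := (fP y).2.
have Ainj x y : A x = A y -> x = y.
  by move=> Axy; apply/eqP; rewrite -subr_eq0; apply/eqP/injA; rewrite boprB Axy subrr.
have [|B BE] := @mk_bop f c _ fc.
  by move=> a x y; apply: Ainj; rewrite linearP !Af.
exists B; last by move=> x; rewrite BE.
by split; apply: bopP => x; rewrite !bopE BE; [exact: Af | apply: Ainj; exact: Af].
Qed.

(** The inverse is built pointwise, as the limit at each vector of the partial
sums of the Neumann series; only the completeness of [X] enters. *)
Lemma neumann A c : 0 <= c -> c < 1 -> op_le A c ->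
  exists2 B, inverse (1 - A) B & op_le B (1 - c)^-1.
Proof.
move=> c0 c1 Ac; have c1' : 0 < 1 - c by lra.
apply: inverse_bij => [x /eqP|y].
  rewrite !bopE subr_eq0 => /eqP xE; apply: nrm_eq0; apply/eqP.
  rewrite eq_le nrm_ge0 andbT -(pmulr_rle0 _ c1') mulrBl mul1r.
  by have := Ac x; rewrite -xE; lra.
have Aky k : nrm ((A ^+ k) y) <= c ^+ k * nrm y by exact: op_leX.
pose u k := \sum_(j < k) (A ^+ j) y.
have uS k : u k.+1 = u k + (A ^+ k) y by rewrite /u big_ord_recr.
have uA k : (1 - A) (u k) = y - (A ^+ k) y.
  elim: k => [|k IH]; first by rewrite /u big_ord0 bopr0 expr0 bop1E subrr.
  by rewrite uS boprD IH exprS !bopE addrA subrK.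
have [||l lu] := @geometric_increments u (fun k => c ^+ k * nrm y) c c0 c1.
- by move=> k; rewrite uS addrC addKr.
- by move=> k; rewrite exprS mulrA.
exists l; last first.
  by have := lu 0; rewrite /u big_ord0 subr0 expr0 mul1r mulrC.
apply/eqP; rewrite -subr_eq0; apply/eqP/nrm_eq0/eqP.
rewrite eq_le nrm_ge0 andbT.
apply: (@le_geometric0 _ c _ ((1 + c) * (nrm y / (1 - c)) + nrm y)) => // k.
have -> : (1 - A) l - y = (1 - A) (l - u k) - (A ^+ k) y.
  by rewrite boprB uA -addrA; congr (_ + _); rewrite opprB addrAC subrr add0r.
rewrite (le_trans (nrmD _ _))// nrmN mulrDr lerD//.
have H : op_le (1 - A) (1 + c) by apply: op_leD op_le1 (op_leN Ac).
rewrite (le_trans (H _))// mulrCA ler_wpM2l ?addr_ge0//.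
by rewrite mulrA.
Qed.

(** A gliding hump in place of a category argument.  The functionals
[y |-> inf_(x, z) (nrm x + nrm z + n * nrm (y - (A x + B z)))] are bounded in [n] at
every [y] of the form [A x + B z]; were they not uniformly bounded, a rapidly
convergent series of humps would produce a point where they are unbounded. *)
Lemma approximately_open A B : (forall y, exists x z, y = A x + B z) ->
  exists K : nat, forall (n : nat) y, exists x z,
    nrm x + nrm z + n%:R * nrm (y - (A x + B z)) <= K%:R * nrm y.
Proof.
move=> surj.
pose qb n y c := exists x z, nrm x + nrm z + n%:R * nrm (y - (A x + B z)) <= c.
apply: contrapT => /forallNP unb.
have {}unb (K : nat) : exists n y, ~ qb n y (K%:R * nrm y).
  have := unb K; rewrite -existsNP => -[n]; rewrite -existsNP => -[y nq].
  by exists n, y.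
have qb0 n : qb n 0 0.
  by exists 0, 0; rewrite !bopr0 addr0 subrr !nrm0 mulr0 !addr0.
have qb_weaken n y c d : qb n y c -> c <= d -> qb n y d.
  by move=> [x [z h]] cd; exists x, z; exact: le_trans cd.
have qbZ n y c (a : Cplx R) : qb n y c -> qb n (a *: y) (cabs a * c).
  move=> [x [z h]]; exists (a *: x), (a *: z).
  rewrite !boprZ -scalerDr -scalerBr !nrmZ mulrCA -!mulrDr.
  by rewrite ler_wpM2l// cabs_ge0.
have qbD n y y' c d : qb n y c -> qb n y' d -> qb n (y + y') (c + d).
  move=> [x [z h]] [x' [z' h']]; exists (x + x'), (z + z').
  have -> : y + y' - (A (x + x') + B (z + z')) =
      y - (A x + B z) + (y' - (A x' + B z')).
    by rewrite !boprD [A x + _ + _]addrACA opprD addrACA.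
  have := nrmD x x'; have := nrmD z z'.
  have := ler_wpM2l (ler0n R n) (nrmD (y - (A x + B z)) (y' - (A x' + B z'))).
  lra.
have hump (k : nat) x r : 0 < r ->
    exists n x', nrm (x' - x) <= r /\ ~ qb n x' k%:R.
  move=> r0; pose K := (Num.truncn (k%:R / r)).+1.
  have [n [y nq]] := unb K.
  have y0 : y != 0.
    by apply: contra_notN nq => /eqP->; rewrite nrm0 mulr0; exact: qb0.
  have ny0 := nrm_gt0 y0.
  pose a : Cplx R := (r / nrm y)%:C%C.
  have ca : cabs a = r / nrm y by rewrite cabs_real ger0_norm// ltW// divr_gt0.
  have a0 : a != 0.
    apply/eqP => /(congr1 (@cabs R)); rewrite ca cabs0 => /eqP.
    by rewrite gt_eqF// divr_gt0.
  have nq' : ~ qb n (a *: y) k%:R.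
    move=> /(qbZ _ _ _ a^-1); rewrite scalerA mulVf// scale1r cabsV ca => h.
    apply: nq; apply: qb_weaken h _.
    rewrite invf_div mulrC mulrA mulrAC ler_wpM2r ?nrm_ge0//.
    by rewrite ltW// truncnS_gt.
  have nay : nrm (a *: y) = r by rewrite nrmZ ca divfK// gt_eqF.
  (* [2 *: (a *: y)] is the difference of [x + a *: y] and [x - a *: y], so one of
     the two must be a hump. *)
  have [q1|] := pselect (qb n (x + a *: y) k%:R); last first.
    by exists n, (x + a *: y); split=> //; rewrite addrC addKr nay.
  exists n, (x - a *: y); split; first by rewrite addrC addKr nrmN nay.
  move=> /(qbZ _ _ _ (-1)); rewrite cabsN cabs1 mul1r scaleN1r opprB => q2.
  apply: nq'; have := qbZ _ _ _ (2^-1) (qbD _ _ _ _ _ q1 q2).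
  have -> : x + a *: y + (a *: y - x) = 2 *: (a *: y).
    by rewrite [LHS]addrC addrA subrK scaler_nat mulr2n.
  rewrite scalerA mulVf ?pnatr_eq0// scale1r => h.
  apply: qb_weaken h _; rewrite cabsV.
  have -> : cabs (2 : Cplx R) = 2.
    by rewrite -[2 in LHS](rmorph_nat (real_complex R)) cabs_real ger0_norm.
  lra.
have /choice[g gP] : forall kxr : nat * X * R, exists nx : nat * X,
    0 < kxr.2 -> nrm (nx.2 - kxr.1.2) <= kxr.2 /\ ~ qb nx.1 nx.2 kxr.1.1%:R.
  move=> [[k x] r] /=; have [r0|r0] := ltP 0 r; last by exists (0%N, x).
  by have [n [x' h]] := hump k x r r0; exists (n, x').
(* The radii shrink by the factor [2 * (n + 1)], where [n] is the index of the last
   hump: the later humps then change that functional by at most 1. *)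
pose fix s k : X * R := if k is k.+1 then
  let nx := g (k, (s k).1, (s k).2) in (nx.2, (s k).2 / 2 / nx.1.+1%:R)
  else (0, 1).
pose n k := (g (k, (s k).1, (s k).2)).1.
have sr0 k : 0 < (s k).2.
  by elim: k => [//|k IH]; rewrite /= divr_gt0// divr_gt0.
have sS k : nrm ((s k.+1).1 - (s k).1) <= (s k).2 /\
    ~ qb (n k) (s k.+1).1 k%:R.
  exact: (gP (k, (s k).1, (s k).2) (sr0 k)).
have sr k : (s k.+1).2 = (s k).2 / 2 / (n k).+1%:R by [].
have sr2 k : (s k.+1).2 <= 2^-1 * (s k).2.
  rewrite sr [2^-1 * _]mulrC ler_piMr//; first by rewrite ltW// divr_gt0.
  by rewrite invf_le1// ler1n.
have [||||l ls] := @geometric_increments (fun k => (s k).1) (fun k => (s k).2) 2^-1.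
- by rewrite invr_ge0.
- by rewrite invf_lt1// ltr1n.
- by move=> k; case: (sS k).
- exact: sr2.
have [x [z lE]] := surj l.
pose k := (Num.truncn (nrm x + nrm z + 1)).+1.
have [_ []] := sS k; exists x, z.
have kN : nrm x + nrm z + 1 < k%:R by exact: truncnS_gt.
apply: le_trans (ltW kN); rewrite lerD2l -lE nrmB.
have := ls k.+1; have -> : (1 - 2^-1 : R) = 2^-1 by lra.
rewrite invrK => h; rewrite (le_trans (ler_wpM2l (ler0n R (n k)) h))//.
have sk1 : (s k).2 <= 1.
  elim: k {kN h} => [//|k IH]; rewrite (le_trans (sr2 k))//; lra.
have -> : (n k)%:R * ((s k.+1).2 * 2) = (s k).2 * ((n k)%:R / (n k).+1%:R).
  have : (n k).+1%:R != 0 :> R by rewrite pnatr_eq0.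
  by rewrite sr; set N := _.+1%:R; move: N => N N0; field.
apply: mulr_ile1 => //; first exact: ltW.
by rewrite ler_pdivrMr// mul1r ler_nat.
Qed.

(** The two-operator form covers a Fredholm [A], with [B] projecting onto a
complement of the range, without a Banach space structure on the direct sum.
Approximate solutions with an error of half the size are summed up. *)
Lemma open_mapping A B : (forall y, exists x z, y = A x + B z) ->
  exists2 C : R, 0 <= C & forall y, exists x z,
    [/\ y = A x + B z, nrm x <= C * nrm y & nrm z <= C * nrm y].
Proof.
move=> /approximately_open[K KP].
have half y : exists xz : X * X, [/\ nrm xz.1 <= K%:R * nrm y,
    nrm xz.2 <= K%:R * nrm y
  & nrm (y - (A xz.1 + B xz.2)) <= 2^-1 * nrm y].
  have [x [z]] := KP (K.*2.+1) y.
  move: (nrm_ge0 x) (nrm_ge0 z) (nrm_ge0 (y - (A x + B z))).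
  set d := nrm (y - _) => x0 z0 d0 h; exists (x, z) => /=; rewrite -/d.
  have Kd : 0 <= K.*2.+1%:R * d by rewrite mulr_ge0.
  split; [lra|lra|].
  have [K0|K0] := posnP K.
    rewrite K0 mul0r mul1r in h; suff -> : d = 0 by rewrite mulr_ge0 ?nrm_ge0.
    by apply/eqP; rewrite eq_le d0 andbT; lra.
  have K0' : 0 < K%:R :> R by rewrite ltr0n.
  rewrite -(ler_pM2l K0'); move: h; rewrite -addn1 natrD -muln2 natrM; nra.
have {half} /choice[f fP] := half.
move: (ler0n R K) => K0.
exists (K%:R * 2) => [|y]; first by rewrite mulr_ge0.
pose r k := iter k (fun v => v - (A (f v).1 + B (f v).2)) y.
have rle k : nrm (r k) <= 2^-1 ^+ k * nrm y.
  elim: k => [|k IH]; first by rewrite expr0 mul1r.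
  have [_ _ h] := fP (r k); rewrite (le_trans h)// exprS -mulrA.
  by apply: ler_wpM2l IH; rewrite invr_ge0.
have conv (p : X -> X) : (forall v, nrm (p v) <= K%:R * nrm v) ->
    exists l, forall k,
      nrm (l - \sum_(j < k) p (r j)) <= 2^-1 ^+ k * (K%:R * nrm y * 2).
  move=> pP; have [||||l lP] := @geometric_increments
      (fun k => \sum_(j < k) p (r j)) (fun k => 2^-1 ^+ k * (K%:R * nrm y)) 2^-1.
  - by rewrite invr_ge0.
  - by rewrite invf_lt1// ltr1n.
  - move=> k; rewrite [X in X - _](_ : _ = \sum_(j < k) p (r j) + p (r k)).
      rewrite addrC addKr (le_trans (pP _))//.
      by rewrite mulrCA ler_wpM2l.
    by rewrite big_ord_recr.
  - by move=> k; rewrite exprS -!mulrA.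
  exists l => k; rewrite (le_trans (lP k))//.
  have -> : (1 - 2^-1 : R) = 2^-1 by lra.
  by rewrite invrK -!mulrA.
have [|x xP] := conv (fun v => (f v).1); first by move=> v; case: (fP v).
have [|z zP] := conv (fun v => (f v).2); first by move=> v; case: (fP v).
exists x, z; split; last first.
- by have := zP 0; rewrite big_ord0 subr0 expr0 mul1r mulrAC.
- by have := xP 0; rewrite big_ord0 subr0 expr0 mul1r mulrAC.
have rE k : y = A (\sum_(j < k) (f (r j)).1) + B (\sum_(j < k) (f (r j)).2) + r k.
  elim: k => [|k IH]; first by rewrite !big_ord0 !bopr0 !add0r.
  rewrite !big_ord_recr !boprD /= [in LHS]IH [X in _ = X + _]addrACA -[RHS]addrA.
  by congr (_ + _); rewrite [RHS]addrC subrK.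
have [a a0 Aa] := op_le_ex A; have [b b0 Bb] := op_le_ex B.
apply/eqP; rewrite -subr_eq0; apply/eqP/nrm_eq0/eqP.
rewrite eq_le nrm_ge0 andbT.
apply: (@le_geometric0 _ 2^-1 _ (a * (K%:R * nrm y * 2) + b * (K%:R * nrm y * 2) + nrm y)).
- by rewrite invr_ge0.
- by rewrite invf_lt1// ltr1n.
move=> k; set sx := \sum_(j < k) (f (r j)).1; set sz := \sum_(j < k) (f (r j)).2.
have -> : y - (A x + B z) = r k - (A (x - sx) + B (z - sz)).
  rewrite !boprB [X in _ = _ - X]addrACA -[X in _ = _ - (_ + X)]opprD.
  by rewrite [RHS]addrC opprB addrAC [in LHS](rE k).
rewrite (le_trans (nrmD _ _))// nrmN addrC mulrDr lerD//.
rewrite (le_trans (nrmD _ _))// mulrDr lerD//.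
  by rewrite (le_trans (Aa _))// mulrCA; exact: ler_wpM2l (ltW a0) _ _ (xP k).
by rewrite (le_trans (Bb _))// mulrCA; exact: ler_wpM2l (ltW b0) _ _ (zP k).
Qed.

Lemma bijective_invertible A : (forall x, A x = 0 -> x = 0) ->
  (forall y, exists x, A x = y) -> invertible A.
Proof.
move=> injA surjA.
have [|C C0 AC] := @open_mapping A 0.
  by move=> y; have [x <-] := surjA y; exists x, 0; rewrite bop0E addr0.
have [|B AB _] := inverse_bij (c := C) injA; last by exists B.
by move=> y; have [x [z []]] := AC y; rewrite bop0E addr0 => -> ? _; exists x.
Qed.

End Banach.

(** * Linear algebra modulo a subspace *)

Section QuotientBases.
Variables (R : realType) (X : lmodType (Cplx R)).
Local Notation K := (Cplx R).
Implicit Types (V W : set X) (x y : X).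

Definition subspace V := V 0 /\ forall (a : K) x y, V x -> V y -> V (a *: x + y).

Definition indep W n (e : 'I_n -> X) :=
  forall c : 'I_n -> K, W (\sum_i c i *: e i) -> forall i, c i = 0.

Definition spans V W n (e : 'I_n -> X) :=
  forall x, V x -> exists c : 'I_n -> K, W (x - \sum_i c i *: e i).

Section Subspace.
Variables (V : set X) (sV : subspace V).

Lemma subspaceZ a x : V x -> V (a *: x).
Proof. by move=> Vx; rewrite -[_ *: _]addr0; apply: sV.2 => //; exact: sV.1. Qed.
Lemma subspaceD x y : V x -> V y -> V (x + y).
Proof. by move=> Vx Vy; rewrite -[x]scale1r; exact: sV.2. Qed.
Lemma subspaceN x : V x -> V (- x).
Proof. by rewrite -scaleN1r; exact: subspaceZ. Qed.
Lemma subspaceB x y : V x -> V y -> V (x - y).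
Proof. by move=> Vx /subspaceN; exact: subspaceD. Qed.
Lemma subspace_sum (I : finType) (F : I -> X) :
  (forall i, V (F i)) -> V (\sum_i F i).
Proof. by move=> VF; apply: big_ind => //; [exact: sV.1|exact: subspaceD]. Qed.
Lemma subspace_addl x y : V x -> V (x + y) -> V y.
Proof. by move=> Vx Vxy; rewrite -[y](addKr x) addrC; exact: subspaceB. Qed.

End Subspace.

Lemma subspace_set0 : subspace [set 0].
Proof. by split=> // a x y -> ->; rewrite scaler0 addr0. Qed.

(** A nonzero row of the kernel of the coefficient matrix would be a dependency. *)
Lemma indep_size W n m (e : 'I_n -> X) (v : 'I_m -> X) : subspace W ->
  indep W e -> (forall i, exists c : 'I_m -> K, W (e i - \sum_j c j *: v j)) ->
  (n <= m)%N.
Proof.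
move=> sW ie /choice[c cP]; rewrite leqNgt; apply/negP => mn.
pose C := \matrix_(i, j) c i j.
have : kermx C != 0.
  rewrite -mxrank_eq0 mxrank_ker subn_eq0 -ltnNge.
  exact: leq_ltn_trans (rank_leq_col C) mn.
move=> /rowV0Pn[a /sub_kermxP aC0]; apply/negP; rewrite negbK.
apply/eqP/rowP => i; rewrite mxE; apply: ie i.
have -> : \sum_i a 0 i *: e i = \sum_i a 0 i *: (e i - \sum_j c i j *: v j).
  under [RHS]eq_bigr do rewrite scalerBr scaler_sumr.
  rewrite sumrB exchange_big /= [X in _ - X]big1 ?subr0// => j _.
  under eq_bigr do rewrite scalerA.
  rewrite -scaler_suml.
  have /rowP/(_ j) := aC0; rewrite !mxE.
  by under eq_bigr do rewrite mxE; move=> ->; rewrite scale0r.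
by apply: subspace_sum => // i; apply: subspaceZ => //; exact: cP.
Qed.

Definition extend n (e : 'I_n -> X) x (i : 'I_n.+1) : X :=
  if unlift ord0 i is Some j then e j else x.

Lemma sum_extend n (e : 'I_n -> X) x (c : 'I_n.+1 -> K) :
  \sum_i c i *: extend e x i =
  c ord0 *: x + \sum_i c (lift ord0 i) *: e i.
Proof.
rewrite big_ord_recl /extend unlift_none; congr (_ + _).
by apply: eq_bigr => i _; rewrite liftK.
Qed.

Lemma indep_extend W n (e : 'I_n -> X) x : indep W e ->
  (forall (a : K) (c : 'I_n -> K), W (a *: x + \sum_i c i *: e i) -> a = 0) ->
  indep W (extend e x).
Proof.
move=> ie ax c; rewrite sum_extend => Wc.
have c0 := ax _ _ Wc; move: Wc; rewrite c0 scale0r add0r => /ie cl i.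
by have [j ->|->//] := unliftP ord0 i; exact: cl.
Qed.

(** A maximal family independent modulo [W] spans modulo [W]. *)
Lemma quotient_basis_ex V W m (v : 'I_m -> X) : subspace W -> spans V W v ->
  exists n (e : 'I_n -> X), quotient_basis V W e.
Proof.
move=> sW sv.
pose P n := `[< exists e : 'I_n -> X, (forall i, V (e i)) /\ indep W e >].
have P0 : exists n, P n.
  exists 0%N; apply/asboolP; exists (fun=> 0).
  by split=> [[]//|c _ []].
have Pm n : P n -> (n <= m)%N.
  move=> /asboolP[e [Ve ie]]; apply: (indep_size (v := v) sW ie) => i.
  exact: sv.
case: (ex_maxnP P0 Pm) => n /asboolP[e [Ve ie]] nmax.
exists n, e; split=> // x Vx; apply: contrapT => xe.
suff : P n.+1 by move=> /nmax; rewrite ltnn.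
apply/asboolP; exists (extend e x); split.
  by move=> i; rewrite /extend; case: (unlift _ _).
apply: indep_extend => // a c Wac; apply/eqP; apply: contra_notT xe => a0.
exists (fun i => - (a^-1 * c i)).
have -> : x - \sum_i - (a^-1 * c i) *: e i = a^-1 *: (a *: x + \sum_i c i *: e i).
  rewrite scalerDr scalerA mulVf// scale1r scaler_sumr -sumrN; congr (_ + _).
  by apply: eq_bigr => i _; rewrite scaleNr opprK scalerA.
exact: subspaceZ.
Qed.

Lemma quotient_basis_size V W n m (e : 'I_n -> X) (e' : 'I_m -> X) :
  subspace W -> quotient_basis V W e -> quotient_basis V W e' -> n = m.
Proof.
move=> sW [Ve ie se] [Ve' ie' se']; apply/eqP; rewrite eqn_leq.
apply/andP; split.
  by apply: indep_size ie _ => // i; exact: se'.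
by apply: indep_size ie' _ => // i; exact: se.
Qed.

Lemma dimE V n : has_dim V n -> Defs.dim V = n.
Proof.
move=> [e be]; rewrite /Defs.dim; case: xgetP => [m _ [e' be']|/(_ n)/=]; last first.
  by case; exists e.
exact: quotient_basis_size subspace_set0 be' be.
Qed.

Lemma codimE V n : subspace V -> has_codim V n -> codim V = n.
Proof.
move=> sV [e be]; rewrite /codim; case: xgetP => [m _ [e' be']|/(_ n)/=]; last first.
  by case; exists e.
exact: quotient_basis_size sV be' be.
Qed.

Lemma has_dim_sub_eq V V' n : subspace V -> V `<=` V' ->
  has_dim V n -> has_dim V' n -> V = V'.
Proof.
move=> sV VV' [e [Ve ie se]] [e' [Ve' ie' se']]; apply/seteqP; split=> // x V'x.
apply: contrapT => Vx; suff : (n.+1 <= n)%N by rewrite ltnn.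
apply: (@indep_size [set 0] _ _ (extend e x) e' subspace_set0).
  apply: indep_extend => // a c /eqP; rewrite addrC addr_eq0 => /eqP ac.
  apply/eqP; apply: contra_notT Vx => a0.
  rewrite -[x]scale1r -(mulVf a0) -scalerA -[a *: x]opprK -ac.
  apply/(subspaceZ sV)/(subspaceN sV)/(subspace_sum sV) => i.
  exact: subspaceZ.
move=> i; apply: se'; rewrite /extend; case: (unlift _ _) => [j|//].
exact: VV'.
Qed.

(** A basis of [X] modulo [V'] together with a vector of [V'] outside [V] would be
too large an independent family modulo [V]. *)
Lemma has_codim_sub_eq V V' n : subspace V -> subspace V' -> V `<=` V' ->
  has_codim V n -> has_codim V' n -> V = V'.
Proof.
move=> sV sV' VV' [e [_ ie se]] [e' [_ ie' se']]; apply/seteqP; split=> // x V'x.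
apply: contrapT => Vx; suff : (n.+1 <= n)%N by rewrite ltnn.
apply: (@indep_size V _ _ (extend e' x) e sV); last by move=> i; exact: se.
apply: indep_extend => [c /VV'/ie'//|a c Vac].
have c0 : forall i, c i = 0.
  by apply: ie'; apply: (subspace_addl sV' (subspaceZ sV' a V'x)); exact: VV'.
move: Vac; rewrite big1 ?addr0 => [Vax|i _]; last by rewrite c0 scale0r.
apply/eqP; apply: contra_notT Vx => a0.
by rewrite -[x]scale1r -(mulVf a0) -scalerA; exact: subspaceZ.
Qed.

Lemma finite_dimP V n (v : 'I_n -> X) :
  (forall x, V x -> exists c : 'I_n -> K, x = \sum_i c i *: v i) ->
  finite_dim V.
Proof.
move=> sv; have [|m [e be]] := @quotient_basis_ex V [set 0] n v subspace_set0.
  by move=> x /sv[c ->]; exists c => /=; rewrite subrr.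
by exists m, e.
Qed.

Lemma has_dim_sub V V' n n' : V `<=` V' -> has_dim V n -> has_dim V' n' ->
  (n <= n')%N.
Proof.
move=> VV' [e [Ve ie se]] [e' [Ve' ie' se']].
by apply: indep_size subspace_set0 ie _ => i; apply: se'; exact: VV'.
Qed.

(** The term of least dimension is the limit of the sequence. *)
Lemma nonincreasing_stable (V : nat -> set X) : (forall n, subspace (V n)) ->
  (forall n, V n.+1 `<=` V n) -> finite_dim (V 0%N) ->
  exists n, forall m, (n <= m)%N -> V m = V n.
Proof.
move=> sV Vdec fd.
have Vle n m : (n <= m)%N -> V m `<=` V n.
  move=> /subnKC <-; elim: (m - n)%N => [|k IH]; first by rewrite addn0.
  by rewrite addnS => x /Vdec/IH.
have [N [e be]] := fd.
have fdV n : exists d, has_dim (V n) d.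
  apply: (finite_dimP (v := e)) => x /(Vle 0%N) Vx.
  case: be => _ _ /(_ x (Vx (leq0n n)))[c /subr0_eq ->]; by exists c.
have [d dP] := choice fdV.
have dle n m : (n <= m)%N -> (d m <= d n)%N.
  by move=> nm; exact: has_dim_sub (Vle _ _ nm) (dP m) (dP n).
have [D DP] : exists D, exists n, d n = D by exists (d 0%N), 0%N.
pose P k := `[< exists n, d n = k >].
have exP : exists k, P k by exists (d 0%N); apply/asboolP; exists 0%N.
case: (ex_minnP exP) => k /asboolP[n dn] kmin.
exists n => m nm; apply: has_dim_sub_eq (sV m) (Vle _ _ nm) (dP m) _.
suff -> : d m = d n by exact: dP.
apply/eqP; rewrite eqn_leq dle//= dn; apply: kmin.
by apply/asboolP; exists m.
Qed.

Lemma nondecreasing_stable (V : nat -> set X) n (v : 'I_n -> X) :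
  (forall n, subspace (V n)) -> (forall n, V n `<=` V n.+1) ->
  (forall k x, V k x -> exists c : 'I_n -> K, x = \sum_i c i *: v i) ->
  exists k, V k = V k.+1.
Proof.
move=> sV Vinc sv; have fdV k : exists d, has_dim (V k) d.
  exact: finite_dimP (sv k).
have [d dP] := choice fdV.
pose P k := `[< exists i, d i = k >].
have exP : exists k, P k by exists (d 0%N); apply/asboolP; exists 0%N.
have ubP k : P k -> (k <= n)%N.
  move=> /asboolP[i <-]; have [e [Ve ie _]] := dP i.
  apply: (indep_size (v := v) subspace_set0 ie) => j.
  by have [c ->] := sv _ _ (Ve j); exists c => /=; rewrite subrr.
case: (ex_maxnP exP ubP) => k /asboolP[i di] kmax.
exists i; apply: has_dim_sub_eq (sV i) (Vinc i) (dP i) _.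
suff -> : d i = d i.+1 by exact: dP.
apply/eqP; rewrite eqn_leq (has_dim_sub (@Vinc i) (dP i) (dP i.+1))/= di.
by apply: kmax; apply/asboolP; exists i.+1.
Qed.

End QuotientBases.

Section FredholmAlternative.
Variables (R : realType) (X : lmodType (Cplx R)) (G : {linear X -> X}).
Local Notation K := (Cplx R).

(** In a basis [e] of the range of [G] the map [1 + G] acts on coordinate rows
as a square matrix [M]; the kernel of [1 + G] corresponds to the kernel of [M]
and the cokernel of [1 + G] to a complement of the row space of [M]. *)
Lemma fredholm_alternative m (v : 'I_m -> X) :
  (forall x, exists c : 'I_m -> K, G x = \sum_i c i *: v i) ->
  exists n, has_dim [set x | x + G x = 0] n /\
            has_codim (range (fun x => x + G x)) n.
Proof.
move=> Gv; have [|k [e [Ve ie se]]] :=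
  @quotient_basis_ex R X (range G) [set 0] m v (subspace_set0 X).
  by move=> _ [x _ <-]; have [c ->] := Gv x; exists c => /=; rewrite subrr.
pose E (a : 'rV[K]_k) := \sum_i a 0 i *: e i.
have ED a b : E (a + b) = E a + E b.
  by rewrite /E -big_split; apply: eq_bigr => i _; rewrite mxE scalerDl.
have EN a : E (- a) = - E a.
  by rewrite /E -sumrN; apply: eq_bigr => i _; rewrite mxE scaleNr.
have EB a b : E (a - b) = E a - E b by rewrite ED EN.
have E0 a : E a = 0 -> a = 0.
  by move=> /ie a0; apply/rowP => i; rewrite mxE a0.
have Einj a b : E a = E b -> a = b.
  by move=> Eab; apply/eqP; rewrite -subr_eq0; apply/eqP/E0; rewrite EB Eab subrr.
have Emul n (c : 'rV[K]_n) (A : 'M[K]_(n, k)) : E (c *m A) = \sum_i c 0 i *: E (row i A).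
  rewrite /E; under eq_bigr do rewrite mxE scaler_suml.
  rewrite exchange_big; apply: eq_bigr => i _; rewrite scaler_sumr.
  by apply: eq_bigr => j _; rewrite mxE scalerA.
have GE x : exists a, G x = E a.
  have [|c /subr0_eq ->] := se (G x); first by exists x.
  by exists (\row_i c i); apply: eq_bigr => i _; rewrite mxE.
have [M ME] : exists M : 'M[K]_k, forall i, e i + G (e i) = E (row i M).
  have /choice[f fP] : forall i, exists a, e i + G (e i) = E a.
    move=> i; have [y _ yE] := Ve i; have [a aE] := GE (y + e i).
    by exists a; rewrite -aE raddfD /= yE.
  exists (\matrix_(i, j) f i 0 j) => i; rewrite fP; congr E.
  by apply/rowP => j; rewrite !mxE.
have MM a : E a + G (E a) = E (a *m M).
  rewrite Emul /E raddf_sum -big_split; apply: eq_bigr => i _ /=.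
  by rewrite linearZ -scalerDr ME.
exists (\rank (kermx M)); split.
  exists (fun i => E (row i (row_base (kermx M)))); split.
  - move=> i /=; rewrite MM; suff -> : row i (row_base (kermx M)) *m M = 0.
      by rewrite /E big1// => j _; rewrite mxE scale0r.
    by apply/sub_kermxP; apply: submx_trans (row_sub _ _) _; rewrite eq_row_base.
  - move=> c /=; pose cr := \row_i c i.
    have -> : \sum_i c i *: E (row i (row_base (kermx M))) = E (cr *m row_base (kermx M)).
      by rewrite Emul; apply: eq_bigr => i _; rewrite mxE.
    move=> /E0 c0 i; have : cr = 0.
      by apply: (row_free_inj (row_base_free (kermx M))); rewrite mul0mx.
    by move=> /rowP/(_ i); rewrite !mxE.
  - move=> x /= xG; have [a aE] := GE (- x).
    have xE : x = E a by rewrite -aE raddfN; apply/eqP; rewrite -addr_eq0 xG.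
    have aM : a *m M = 0 by apply: E0; rewrite -MM -xE.
    have : (a <= row_base (kermx M))%MS by rewrite eq_row_base; apply/sub_kermxP.
    move=> /submxP[c cE]; exists (fun i => c 0 i).
    by rewrite -Emul -cE -xE subrr.
have -> : \rank (kermx M) = \rank (M^C)%MS by rewrite mxrank_ker mxrank_compl.
exists (fun i => E (row i (row_base (M^C)%MS))); split=> //.
- move=> c [x _ xE]; pose cr := \row_i c i.
  move: xE.
  have -> : \sum_i c i *: E (row i (row_base (M^C)%MS)) = E (cr *m row_base (M^C)%MS).
    by rewrite Emul; apply: eq_bigr => i _; rewrite mxE.
  move=> xE; have [a aE] := GE x.
  have {}xE : x = E (cr *m row_base (M^C)%MS - a) by rewrite EB -aE -xE addrK.
  set b := cr *m _ - a in xE.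
  have : E (cr *m row_base (M^C)%MS) = E (b *m M).
    by rewrite -MM -xE aE xE /b EB subrK.
  move=> /Einj cb i; have : cr = 0.
    apply: (row_free_inj (row_base_free (M^C)%MS)); rewrite mul0mx.
    apply/eqP; rewrite -submx0 -(capmx_compl M) sub_capmx.
    by rewrite {1}cb submxMl (submx_trans (submxMl _ _))// eq_row_base.
  by move=> /rowP/(_ i); rewrite !mxE.
- move=> x _; have [a aE] := GE x.
  have : (- a <= M + row_base (M^C))%MS.
    by rewrite (adds_eqmx (eqmx_refl M) (eq_row_base (M^C)%MS)) submx_full// addsmx_compl_full.
  move=> /sub_addsmxP[[b c] /= abc]; exists (fun i => c 0 i).
  rewrite -Emul; exists (x + E b) => //=.
  rewrite raddfD /= addrACA MM aE.
  have -> : E (c *m row_base (M^C)%MS) = E (- a) - E (b *m M).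
    by rewrite abc ED [X in X - _]addrC addrK.
  by rewrite EN opprB opprK -addrA [E a + _]addrC.
Qed.

End FredholmAlternative.

(** * Operators modulo finite rank *)

Section FiniteRank.
Variables (R : realType) (X : completeNormedModType (Cplx R)).
Local Notation K := (Cplx R).
Local Notation bop := (bop X).
Implicit Types (A B C F J : bop) (x y : X).

Definition finite_rank A := exists n (v : 'I_n -> X),
  forall x, exists c : 'I_n -> K, A x = \sum_i c i *: v i.

Lemma finite_rank0 : finite_rank 0.
Proof.
exists 0%N, (fun=> 0) => x; exists (fun=> 0).
by rewrite big_ord0 bop0E.
Qed.

Lemma finite_rankD A B : finite_rank A -> finite_rank B -> finite_rank (A + B).
Proof.
move=> [n [v Av]] [m [w Bw]].
exists (n + m)%N, (fun i => match fintype.split i with inl j => v j | inr k => w k end).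
move=> x; have [c Ax] := Av x; have [d Bx] := Bw x.
exists (fun i => match fintype.split i with inl j => c j | inr k => d k end).
rewrite bopDE Ax Bx big_split_ord /=; congr (_ + _); apply: eq_bigr => i _.
  by rewrite (unsplitK (inl i)).
by rewrite (unsplitK (inr i)).
Qed.

Lemma finite_rankMl A B : finite_rank A -> finite_rank (B * A).
Proof.
move=> [n [v Av]]; exists n, (B \o v) => x; have [c Ax] := Av x; exists c.
by rewrite bopME Ax bopr_sum; apply: eq_bigr => i _; rewrite boprZ.
Qed.

Lemma finite_rankMr A B : finite_rank A -> finite_rank (A * B).
Proof.
by move=> [n [v Av]]; exists n, v => x; rewrite bopME; exact: Av.
Qed.

Lemma finite_rankZ a A : finite_rank A -> finite_rank (a *: A).
Proof. by move=> fA; rewrite -[A]mul1r bop_scalerAl; exact: finite_rankMl. Qed.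

Lemma finite_rankN A : finite_rank A -> finite_rank (- A).
Proof. by rewrite -scaleN1r; exact: finite_rankZ. Qed.

Lemma finite_rankB A B : finite_rank A -> finite_rank B -> finite_rank (A - B).
Proof. by move=> fA /finite_rankN; exact: finite_rankD. Qed.

(** Stands in for equality in the quotient ring by the ideal of finite-rank operators,
which is never formed. *)
Definition eqfr A B := finite_rank (A - B).
Local Notation "A ≈ B" := (eqfr A B).

Lemma eqfr_refl A : A ≈ A.
Proof. by rewrite /eqfr subrr; exact: finite_rank0. Qed.
Lemma eqfr_sym A B : A ≈ B -> B ≈ A.
Proof. by move=> AB; rewrite /eqfr -opprB; exact: finite_rankN. Qed.
Lemma eqfr_trans B A C : A ≈ B -> B ≈ C -> A ≈ C.
Proof.
by move=> AB BC; rewrite /eqfr -[A](subrK B) -addrA; exact: finite_rankD.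
Qed.
Lemma eqfrD A B A' B' : A ≈ A' -> B ≈ B' -> A + B ≈ A' + B'.
Proof. by move=> h h'; rewrite /eqfr opprD addrACA; exact: finite_rankD. Qed.
Lemma eqfrN A A' : A ≈ A' -> - A ≈ - A'.
Proof. by move=> h; rewrite /eqfr -opprD; exact: finite_rankN. Qed.
Lemma eqfrB A B A' B' : A ≈ A' -> B ≈ B' -> A - B ≈ A' - B'.
Proof. by move=> h h'; apply: eqfrD => //; exact: eqfrN. Qed.
Lemma eqfrZ a A A' : A ≈ A' -> a *: A ≈ a *: A'.
Proof. by move=> h; rewrite /eqfr -scalerBr; exact: finite_rankZ. Qed.
Lemma eqfrM A B A' B' : A ≈ A' -> B ≈ B' -> A * B ≈ A' * B'.
Proof.
move=> h h'; apply: (@eqfr_trans (A * B')); rewrite /eqfr.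
  by rewrite -mulrBr; exact: finite_rankMl.
by rewrite -mulrBl; exact: finite_rankMr.
Qed.
Lemma eqfrX A A' n : A ≈ A' -> A ^+ n ≈ A' ^+ n.
Proof.
move=> h; elim: n => [|n IH]; first by rewrite !expr0; exact: eqfr_refl.
by rewrite !exprS; exact: eqfrM.
Qed.
Lemma eqfrMl A B B' : B ≈ B' -> A * B ≈ A * B'.
Proof. exact/eqfrM/eqfr_refl. Qed.
Lemma eqfrMr A B B' : B ≈ B' -> B * A ≈ B' * A.
Proof. by move=> h; apply: eqfrM h (eqfr_refl _). Qed.

Definition finv A B := A * B ≈ 1 /\ B * A ≈ 1.

(** Atkinson's form of the Fredholm property ([fredholm_finvertible]). *)
Definition finvertible A := exists B, finv A B.

(** Left and right inverses agree in the quotient ring. *)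
Lemma finvertible_lr A B C : B * A ≈ 1 -> A * C ≈ 1 -> finvertible A.
Proof.
move=> BA AC; have BC : C ≈ B.
  apply: (@eqfr_trans (B * (A * C))).
    rewrite mulrA -{1}[C]mul1r; exact/eqfrMr/eqfr_sym.
  by rewrite -{2}[B]mulr1; exact: eqfrMl.
exists C; split=> //; apply: eqfr_trans BA; exact: eqfrMr.
Qed.

Lemma invertible1 : invertible (1 : bop).
Proof. by exists 1; split; rewrite mulr1. Qed.

Lemma invertibleM A B : invertible A -> invertible B -> invertible (A * B).
Proof.
move=> [A' [AA' A'A]] [B' [BB' B'B]]; exists (B' * A'); split.
  by rewrite mulrA -(mulrA A) BB' mulr1.
by rewrite mulrA -(mulrA B') A'A mulr1.
Qed.

Lemma invertibleZ a A : a != 0 -> invertible A -> invertible (a *: A).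
Proof.
move=> a0 [A' [AA' A'A]]; exists (a^-1 *: A'); split.
  by rewrite -bop_scalerAl -bop_scalerAr scalerA divff// AA' scale1r.
by rewrite -bop_scalerAl -bop_scalerAr scalerA mulVf// A'A scale1r.
Qed.

(** Invertible plus finite rank.  This is equivalent to being Weyl
([weyl_dec_of_weyl], [weyl_of_weyl_dec]) and makes the stability under products,
quotients and finite-rank perturbations immediate, with no index theory. *)
Definition weyl_dec A := exists J, invertible J /\ A ≈ J.

Lemma invertible_weyl_dec A : invertible A -> weyl_dec A.
Proof. by move=> iA; exists A; split=> //; exact: eqfr_refl. Qed.

Lemma eqfr_weyl_dec A B : A ≈ B -> weyl_dec B -> weyl_dec A.
Proof. by move=> AB [J [iJ BJ]]; exists J; split=> //; exact: eqfr_trans BJ. Qed.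

Lemma weyl_decM A B : weyl_dec A -> weyl_dec B -> weyl_dec (A * B).
Proof.
move=> [J [iJ AJ]] [L [iL BL]]; exists (J * L).
by split; [exact: invertibleM|exact: eqfrM].
Qed.

Lemma weyl_decX A n : weyl_dec A -> weyl_dec (A ^+ n).
Proof.
move=> wA; elim: n => [|n IH]; last by rewrite exprS; exact: weyl_decM.
exact/invertible_weyl_dec/invertible1.
Qed.

Lemma weyl_dec_finv A : weyl_dec A -> exists2 B, finv A B & weyl_dec B.
Proof.
move=> [J [[J' [JJ' J'J]] AJ]]; exists J'.
  by split; [rewrite -JJ'; exact: eqfrMr|rewrite -J'J; exact: eqfrMl].
by apply: invertible_weyl_dec; exists J.
Qed.

Lemma weyl_dec_cancell A B : weyl_dec A -> weyl_dec (A * B) -> weyl_dec B.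
Proof.
move=> /weyl_dec_finv[A' [AA' A'A] wA'] wAB.
apply: eqfr_weyl_dec (weyl_decM wA' wAB).
by rewrite mulrA -{1}[B]mul1r; exact/eqfrMr/eqfr_sym.
Qed.

Lemma weyl_dec_cancelr A B : weyl_dec B -> weyl_dec (A * B) -> weyl_dec A.
Proof.
move=> /weyl_dec_finv[B' [BB' B'B] wB'] wAB.
apply: eqfr_weyl_dec (weyl_decM wAB wB').
by rewrite -mulrA -{1}[A]mulr1; exact/eqfrMl/eqfr_sym.
Qed.

(** The bound [c] on the essential norm of [A]; being a relation, it dispenses with the
infimum over finite-rank operators. *)
Definition ess_le A (c : R) := exists2 B, A ≈ B & op_le B c.

Lemma op_ess_le A c : op_le A c -> ess_le A c.
Proof. by move=> Ac; exists A => //; exact: eqfr_refl. Qed.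

Lemma ess_le_eqfr A B c : A ≈ B -> ess_le B c -> ess_le A c.
Proof. by move=> AB [C BC Cc]; exists C => //; exact: eqfr_trans BC. Qed.

Lemma ess_le_weaken A c d : ess_le A c -> c <= d -> ess_le A d.
Proof. by move=> [B AB Bc] cd; exists B => //; exact: op_le_weaken cd. Qed.

Lemma ess_leD A B c d : ess_le A c -> ess_le B d -> ess_le (A + B) (c + d).
Proof.
move=> [A' AA' A'c] [B' BB' B'd].
by exists (A' + B'); [exact: eqfrD|exact: op_leD].
Qed.

Lemma ess_leZ a A c : ess_le A c -> ess_le (a *: A) (cabs a * c).
Proof.
by move=> [B AB Bc]; exists (a *: B); [exact: eqfrZ|exact: op_leZ].
Qed.

Lemma ess_leN A c : ess_le A c -> ess_le (- A) c.
Proof. by move=> [B AB Bc]; exists (- B); [exact: eqfrN|exact: op_leN]. Qed.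

Lemma ess_leM A B c d : 0 <= c -> ess_le A c -> ess_le B d ->
  ess_le (A * B) (c * d).
Proof.
move=> c0 [A' AA' A'c] [B' BB' B'd].
by exists (A' * B'); [exact: eqfrM|exact: op_leM].
Qed.

Lemma ess_le_weyl_dec A c : 0 <= c -> c < 1 -> ess_le A c -> weyl_dec (1 - A).
Proof.
move=> c0 c1 [B AB Bc]; have [C iC _] := neumann c0 c1 Bc.
by exists (1 - B); split; [exists C|apply: eqfrB (eqfr_refl _) AB].
Qed.

End FiniteRank.

Local Notation "A ≈ B" := (eqfr A B).

Section FredholmWeyl.
Variables (R : realType) (X : completeNormedModType (Cplx R)).
Local Notation K := (Cplx R).
Local Notation bop := (bop X).
Implicit Types (A B C F J : bop) (x y : X).

Lemma subspace_null A : subspace (null_space A).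
Proof.
split=> [|a x y] /=; first by rewrite /null_space /= bopr0.
by rewrite /null_space /= boprD boprZ => -> ->; rewrite scaler0 addr0.
Qed.

Lemma subspace_range A : subspace (range A).
Proof.
split=> [|a _ _ [x _ <-] [y _ <-]]; first by exists 0 => //; rewrite bopr0.
by exists (a *: x + y) => //; rewrite boprD boprZ.
Qed.

Lemma finite_rank_bop n (f : 'I_n -> X -> K) (v : 'I_n -> X) :
  (forall i, bounded_functional (f i)) ->
  {F : bop | forall x, F x = \sum_i f i x *: v i}.
Proof.
move=> bf; have fM i := cid (bf i).2.
apply: (@mk_bop _ _ _ (\sum_i sval (fM i) * nrm (v i))) => [a x y|x].
  rewrite scaler_sumr -big_split; apply: eq_bigr => i _ /=.
  by rewrite (bf i).1 scalerDl scalerA.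
rewrite mulr_suml; elim/big_ind2 : _ => [|a a' b b' h h'|i _].
- by rewrite nrm0.
- by rewrite (le_trans (nrmD _ _))// lerD.
by rewrite nrmZ mulrAC ler_wpM2r ?nrm_ge0//; exact: (svalP (fM i)).
Qed.

Lemma finite_rank_sum n F (v : 'I_n -> X) (f : 'I_n -> X -> K) :
  (forall x, F x = \sum_i f i x *: v i) -> finite_rank F.
Proof. by move=> Fv; exists n, v => x; exists (fun i => f i x). Qed.

Lemma set0_quotient_basis n (V : set X) (e : 'I_n -> X) :
  quotient_basis V [set 0] e ->
  (forall c : 'I_n -> K, \sum_i c i *: e i = 0 -> forall i, c i = 0) /\
  (forall x, V x -> exists c : 'I_n -> K, x = \sum_i c i *: e i).
Proof.
by move=> [Ve ie se]; split=> // x /se[c /subr0_eq]; exists c.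
Qed.

Lemma scalar_sum (f : X -> K) n (e : 'I_n -> X) (c : 'I_n -> K) x :
  scalar f -> f (x + \sum_i c i *: e i) = f x + \sum_i c i * f (e i).
Proof.
move=> sf; elim/big_ind2 : _ => [|a a' b b'|i _]; first by rewrite !addr0.
- move=> h h'; have f0 : f 0 = 0.
    by have := sf (-1) 0 0; rewrite scaler0 addr0 mulN1r addNr.
  have fD u w : f (u + w) = f u + f w by rewrite -[u]scale1r sf mul1r scale1r.
  by move: h h'; rewrite !fD => /addrI -> /addrI ->.
- by rewrite addrC sf addrC.
Qed.

Lemma biorthogonal_sum n (f : 'I_n -> X -> K) (e : 'I_n -> X) (c : 'I_n -> K) x i :
  (forall i, bounded_functional (f i)) ->
  (forall i j, f i (e j) = (i == j)%:R) ->
  f i (x + \sum_j c j *: e j) = f i x + c i.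
Proof.
move=> bf fe; rewrite scalar_sum; last exact: (bf i).1.
congr (_ + _); rewrite (bigD1 i)//= fe eqxx mulr1 big1 ?addr0// => j.
by rewrite fe eq_sym => /negbTE ->; rewrite mulr0.
Qed.

Lemma bounded_functional0 (f : X -> K) : bounded_functional f -> f 0 = 0.
Proof. by move=> [sf _]; have := sf (-1) 0 0; rewrite scaler0 addr0 mulN1r addNr. Qed.

(** Send a basis [e] of the kernel onto a basis [w] of a complement of the range:
the finite-rank operator [x |-> \sum_i f i x *: w i], with [f] dual to [e],
completes [A] to a bijection. *)
Lemma weyl_dec_of_weyl A : weyl A -> weyl_dec A.
Proof.
move=> [[[n hn] [m hm]]]; rewrite /fredholm_index (dimE hn).
rewrite (codimE (subspace_range A) hm) => /eqP; rewrite subr_eq0 => /eqP[nm].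
case: _ / nm hm => -[w [_ iw sw]]; case: hn => e be.
have [ie se] := set0_quotient_basis be; have Ne i : A (e i) = 0 by case: be => Ve _ _; exact: Ve.
have [f [bf fe]] := hahn_banach_family ie.
have [F FE] := finite_rank_bop w bf.
exists (A + F); split; last first.
  rewrite /eqfr opprD addrA subrr add0r; apply: finite_rankN.
  exact: finite_rank_sum FE.
apply: bijective_invertible => [x|y].
  rewrite bopDE FE => xE; have fx0 : forall i, f i x = 0.
    apply: iw; exists (- x) => //; rewrite boprN.
    by apply/eqP; rewrite eq_sym -addr_eq0 addrC xE.
  have [|c xc] := se x.
    by move: xE; rewrite [X in _ + X]big1 ?addr0// => i _; rewrite fx0 scale0r.
  rewrite xc big1// => i _; have := fx0 i.
  rewrite xc -[\sum_j _]add0r (biorthogonal_sum _ _ _ bf fe).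
  by rewrite bounded_functional0// add0r => ->; rewrite scale0r.
have [c [x _ xE]] := sw y I.
exists (x + \sum_i (c i - f i x) *: e i).
rewrite bopDE boprD bopr_sum [X in _ + X + _]big1 ?addr0; last first.
  by move=> i _; rewrite boprZ Ne scaler0.
rewrite xE FE -[RHS](subrK (\sum_i c i *: w i)); congr (_ + _).
apply: eq_bigr => j _; congr (_ *: _).
by rewrite (biorthogonal_sum _ _ _ bf fe) addrC subrK.
Qed.

(** Dividing by the invertible part reduces to [1 + G] with [G] of finite rank. *)
Lemma weyl_of_weyl_dec A : weyl_dec A -> weyl A.
Proof.
move=> [J [[J' [JJ' J'J]] AJ]].
have JK x : J (J' x) = x by rewrite -bopME JJ' bop1E.
have J'K x : J' (J x) = x by rewrite -bopME J'J bop1E.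
have [m [v Gv]] : finite_rank (J' * (A - J)) by exact: finite_rankMl.
have [n [hn hm]] := fredholm_alternative Gv.
set G : {linear X -> X} := J' * (A - J) in Gv hn hm.
have GE x : x + G x = J' (A x).
  by rewrite /G bopME bopBE boprB J'K addrC subrK.
have nE : null_space A = [set x | x + G x = 0].
  apply/seteqP; split=> x; rewrite /null_space /= GE.
    by move=> ->; exact: bopr0.
  by move=> J'A0; rewrite -[A x]JK J'A0 bopr0.
have cE : has_codim (range A) n.
  case: hm => e [Ve ie se]; exists (J \o e); split=> //.
  - move=> c [x _ xE]; apply: ie; exists x => //; rewrite GE xE bopr_sum.
    by apply: eq_bigr => i _; rewrite boprZ J'K.
  - move=> x _; have [c [y _]] := se (J' x) I; rewrite GE => yE; exists c.
    exists y => //; rewrite -[LHS]JK yE boprB JK bopr_sum; congr (_ - _).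
    by apply: eq_bigr => i _; rewrite boprZ.
rewrite -nE in hn; split; first by split; exists n.
rewrite /fredholm_index (dimE hn) (codimE (subspace_range A) cE).
exact: subrr.
Qed.

(** A bounded generalized inverse of a Fredholm operator: solve [y = A x] modulo
a complement of the range and normalize the solution by projecting the kernel
of [A] away. *)
Lemma fredholm_generalized_inverse A : fredholm A ->
  exists U, [/\ A * U * A = A, finite_rank (1 - U * A) & finite_rank (1 - A * U)].
Proof.
move=> [[n [e be]] [m [w [_ iw sw]]]].
have [ie se] := set0_quotient_basis be; have Ne i : A (e i) = 0 by case: be => Ve _ _; exact: Ve.
have [f [bf fe]] := hahn_banach_family ie.
have [P PE] := finite_rank_bop e bf.
have AP x : A (P x) = 0.
  by rewrite PE bopr_sum big1// => i _; rewrite boprZ Ne scaler0.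
have Pn x : A x = 0 -> P x = x.
  move=> /se[c ->]; rewrite PE; apply: eq_bigr => i _; congr (_ *: _).
  by rewrite -[\sum_j _]add0r (biorthogonal_sum _ _ _ bf fe) bounded_functional0// add0r.
have iw0 (c : 'I_m -> K) : \sum_i c i *: w i = 0 -> forall i, c i = 0.
  by move=> c0; apply: iw; rewrite c0; exists 0 => //; exact: bopr0.
have [g [bg gw]] := hahn_banach_family iw0.
have [B BE] := finite_rank_bop w bg.
have Bw (c : 'I_m -> K) : B (\sum_i c i *: w i) = \sum_i c i *: w i.
  rewrite BE; apply: eq_bigr => i _; congr (_ *: _).
  by rewrite -[\sum_j _]add0r (biorthogonal_sum _ _ _ bg gw) bounded_functional0// add0r.
have [|C C0 CP] := @open_mapping _ _ A B.
  move=> y; have [c [x _ xE]] := sw y I; exists x, (\sum_i c i *: w i).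
  by rewrite Bw xE subrK.
have ABinj x z : A x + B z = 0 -> A x = 0 /\ B z = 0.
  rewrite BE => xz0; have gz : forall i, g i z = 0.
    apply: iw; exists (- x) => //; rewrite boprN.
    by apply/eqP; rewrite eq_sym -addr_eq0 addrC xz0.
  by move: xz0; rewrite big1 ?addr0// => i _; rewrite gz scale0r.
have /choice[u uP] : forall y, exists u : X, exists z,
    [/\ y = A u + B z & nrm u <= C * nrm y].
  by move=> y; have [x [z [yE xy _]]] := CP y; exists x, z.
have [p p0 Pp] := op_le_ex (1 - P).
have P1 x x' : A x = A x' -> (1 - P) x = (1 - P) x'.
  move=> xx'; apply/eqP; rewrite -subr_eq0 -boprB bopBE bop1E Pn ?subrr//.
  by rewrite boprB xx' subrr.
have uE x y z : y = A x + B z -> (1 - P) (u y) = (1 - P) x.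
  move=> yE; have [z' [yE' _]] := uP y; apply: P1.
  have [|] := @ABinj (x - u y) (z - z').
    rewrite !boprB addrACA -opprD -yE -yE' subrr; reflexivity.
  by rewrite boprB => /subr0_eq.
have [U UE] : {U : bop | forall y, U y = (1 - P) (u y)}.
  apply: (@mk_bop _ _ _ (p * C)) => [a y y'|y]; last first.
    have [z [_ uy]] := uP y; rewrite (le_trans (Pp _))// -mulrA.
    by apply: ler_wpM2l uy; exact: ltW.
  have [z [yE _]] := uP y; have [z' [yE' _]] := uP y'.
  rewrite (@uE (a *: u y + u y') _ (a *: z + z')); last first.
    by rewrite !boprD !boprZ addrACA -scalerDr -yE -yE'.
  by rewrite boprD boprZ.
have AU x : U (A x) = (1 - P) x.
  by rewrite UE; apply: (@uE x _ 0); rewrite bopr0 addr0.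
exists U; split.
- by apply: bopP => x; rewrite !bopME AU bopBE bop1E boprB AP subr0.
- have -> : 1 - U * A = P.
    by apply: bopP => x; rewrite bopBE bopME AU bopBE !bop1E opprB addrC subrK.
  exact: finite_rank_sum PE.
- exists m, w => y; have [z [yE _]] := uP y; exists (fun i => g i z).
  rewrite -BE bopBE bop1E bopME UE bopBE bop1E boprB AP subr0.
  by rewrite {1}yE addrAC subrr add0r.
Qed.

Lemma fredholm_finvertible A : fredholm A -> finvertible A.
Proof.
by move=> /fredholm_generalized_inverse[U [_ UA AU]]; exists U; split; apply: eqfr_sym.
Qed.

Lemma weyl_dec_null_finite A : weyl_dec A -> finite_dim (null_space A).
Proof. by move=> /weyl_of_weyl_dec[[]]. Qed.

Lemma weyl_dec_inj_invertible A : weyl_dec A -> (forall x, A x = 0 -> x = 0) ->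
  invertible A.
Proof.
move=> /weyl_of_weyl_dec[[[n hn] [m hm]]] + injA.
have hn0 : has_dim (null_space A) 0.
  exists (fun=> 0); split=> [[]//|c _ []//|x /injA ->].
  by exists (fun=> 0) => /=; rewrite big_ord0 subr0.
rewrite /fredholm_index (dimE hn0) (codimE (subspace_range A) hm) => /eqP.
rewrite sub0r oppr_eq0 => /eqP[m0]; case: _ / (esym m0) hm => -[e [_ _ se]].
apply: bijective_invertible => // y; have [c [x _]] := se y I.
by rewrite big_ord0 subr0; exists x.
Qed.

End FredholmWeyl.

(** * Essential quasi-nilpotence of Riesz operators *)

Section ComplexDisc.
Variable R : realType.
Local Notation K := (Cplx R).

Lemma cabs_le_ReIm (z : K) : cabs z <= `|complex.Re (z : R[i])| + `|complex.Im (z : R[i])|.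
Proof.
have cI (b : R) : cabs ((('i : R[i]) * b%:C)%C : K) = `|b|.
  rewrite [cabs _](_ : _ = cabs ('i%C : K) * cabs (b%:C%C : K)); last exact: cabsM.
  rewrite cabs_real [cabs _](_ : _ = 1) ?mul1r//.
  by rewrite /cabs normc_def /= expr0n expr1n add0r sqrtr1.
by rewrite {1}[z]complexE (le_trans (cabsD _ _))// cI cabs_real.
Qed.

Lemma ReIm_le_cabs (z : K) :
  `|complex.Re (z : R[i])| <= cabs z /\ `|complex.Im (z : R[i])| <= cabs z.
Proof.
rewrite /cabs normc_def /=.
rewrite -[`|complex.Re _|]sqrtr_sqr -[`|complex.Im _|]sqrtr_sqr.
split; apply: ler_wsqrtr; first by rewrite lerDl sqr_ge0.
by rewrite lerDr sqr_ge0.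
Qed.

(** Compactness of closed discs, in the form: a locally bounded quantity is
bounded on a disc. *)
Lemma disc_bounded (P : K -> nat -> Prop) :
  (forall l n m, (n <= m)%N -> P l n -> P l m) ->
  (forall l0, exists2 d : R, 0 < d &
     exists n, forall l, cabs (l - l0) < d -> P l n) ->
  forall r : R, exists n, forall l, cabs l <= r -> P l n.
Proof.
move=> Pmono Ploc r.
pose S : set (R * R) := `[- r, r]%classic `*` `[- r, r]%classic.
have : compact S by apply: compact_setX; exact: segment_compact.
rewrite compact_near_coveringP => /(_ nat \oo
    (fun n z => P (z.1 +i* z.2)%C n) _)[].
  move=> [x y] _; have [d d0 [n Pn]] := Ploc (x +i* y)%C.
  exists (ball (x, y) (d / 2), [set m | (n <= m)%N]).
    split; last by exists n.
    by apply: nbhsx_ballx; rewrite divr_gt0.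
  move=> [[x' y'] m] /= [[]]; rewrite -!ball_normE /= => hx hy nm.
  apply: Pmono nm (Pn _ _); apply: le_lt_trans (cabs_le_ReIm _) _.
  by rewrite /= distrC [X in _ + X]distrC; lra.
move=> n _ /(_ n (leqnn n)) nP; exists n => l lr.
have [lRe lIm] := ReIm_le_cabs l.
have := nP (complex.Re (l : R[i]), complex.Im (l : R[i])).
case: l lr lRe lIm {nP} => a b lr lRe lIm.
apply; split=> /=; rewrite in_itv /= -ler_norml.
  exact: le_trans lRe lr.
exact: le_trans lIm lr.
Qed.

End ComplexDisc.

Section QuasiNilpotent.
Variables (R : realType) (X : completeNormedModType (Cplx R)).
Local Notation K := (Cplx R).
Local Notation bop := (bop X).
Implicit Types (A B C F J Q : bop) (x y : X).

Lemma finv_sym A B : finv A B -> finv B A.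
Proof. by case. Qed.

Lemma finvZ a A B : a != 0 -> finv A B -> finv (a *: A) (a^-1 *: B).
Proof.
move=> a0 [AB BA]; split; rewrite -bop_scalerAl -bop_scalerAr scalerA.
  by rewrite divff// scale1r.
by rewrite mulVf// scale1r.
Qed.

Lemma finvertibleZ a A : a != 0 -> finvertible A -> finvertible (a *: A).
Proof. by move=> a0 [B AB]; exists (a^-1 *: B); exact: finvZ. Qed.

(** Essential inverses are unique, even against one-sided ones. *)
Lemma finv_left A B C : finv A B -> C * A ≈ 1 -> B ≈ C.
Proof.
move=> [AB BA] CA; apply: (@eqfr_trans _ _ (C * A * B)).
  by rewrite -{1}[B]mul1r; exact/eqfrMr/eqfr_sym.
by rewrite -mulrA -{2}[C]mulr1; exact: eqfrMl.
Qed.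

Lemma ess_leX A c n : 0 <= c -> ess_le A c -> ess_le (A ^+ n) (c ^+ n).
Proof.
by move=> c0 [B AB Bc]; exists (B ^+ n); [exact: eqfrX|exact: op_leX].
Qed.

Lemma ess_le0 : ess_le (0 : bop) 0.
Proof. exact/op_ess_le/op_le0. Qed.

(** The Neumann series modulo finite rank. *)
Lemma finv_sub1_le A B (c : R) : 0 <= c -> c < 1 -> ess_le A c ->
  finv (1 - A) B -> ess_le (B - 1) (c / (1 - c)).
Proof.
move=> c0 c1 [E AE Ec] AB; have [N [EN NE] Nc] := neumann c0 c1 Ec.
have BN : B ≈ N.
  apply: finv_left AB _; rewrite -[X in eqfr _ X]NE.
  exact/eqfrMl/(eqfrB (eqfr_refl _)).
exists (N * E).
  apply: eqfr_trans (eqfrB BN (eqfr_refl 1)) _.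
  have -> : N - 1 = N * E; last exact: eqfr_refl.
  by rewrite -[X in _ - X = _]NE mulrBr mulr1 opprB addrC subrK.
by rewrite mulrC; apply: op_leM => //; rewrite invr_ge0; lra.
Qed.

Section Resolvent.
Variables (Q : bop) (u : K -> bop).
Hypothesis uP : forall l, finv (1 - l *: Q) (u l).

(** Near [l0] the essential resolvent is [(1 - (l - l0) *: (u l0 * Q))^-1 * u l0],
given by a Neumann series. *)
Lemma resolvent_locally_bounded l0 : exists2 d : R, 0 < d &
  exists n : nat, forall l, cabs (l - l0) < d -> ess_le (u l) n%:R.
Proof.
have [c c0 uc] := op_le_ex (u l0); have [q q0 Qq] := op_le_ex Q.
exists (2^-1 / (c * q)); first by rewrite divr_gt0 ?mulr_gt0.
exists (Num.truncn (2 * c)).+1 => l ld.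
pose E := (l - l0) *: (u l0 * Q).
have Ele : op_le E 2^-1.
  apply: op_le_weaken (op_leZ _ (op_leM (ltW c0) uc Qq)) _.
  by rewrite -ler_pdivlMr ?mulr_gt0// ltW.
have [N [EN NE] N2] : exists2 B, inverse (1 - E) B & op_le B 2.
  have h0 : 0 <= 2^-1 :> R by rewrite invr_ge0.
  have h1 : 2^-1 < 1 :> R by rewrite invf_lt1// ltr1n.
  have [B iB Bl] := neumann h0 h1 Ele; exists B => //.
  apply: op_le_weaken Bl _; have -> : 1 - 2^-1 = 2^-1 :> R by lra.
  by rewrite invrK.
have uE : u l0 * (1 - l *: Q) ≈ 1 - E.
  have -> : 1 - l *: Q = (1 - l0 *: Q) - (l - l0) *: Q.
    by rewrite scalerBl opprB addrA subrK.
  rewrite mulrBr -bop_scalerAr; apply: eqfrB (eqfr_refl _).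
  exact: (uP l0).2.
exists (N * u l0).
  apply: finv_left (uP l) _; rewrite -mulrA -[X in eqfr _ X]NE; exact: eqfrMl.
apply: op_le_weaken (op_leM _ N2 uc) _ => //.
by rewrite ltW// truncnS_gt.
Qed.

(** The resolvent identity [u l - u l' ≈ (l - l') *: (u l * Q * u l')]. *)
Lemma resolvent_lipschitz (r : R) : exists2 L : R, 0 < L &
  forall l l', cabs l <= r -> cabs l' <= r ->
    ess_le (u l - u l') (L * cabs (l - l')).
Proof.
have mono l (n m : nat) : (n <= m)%N -> ess_le (u l) n%:R -> ess_le (u l) m%:R.
  by move=> nm h; apply: ess_le_weaken h _; rewrite ler_nat.
have [n un] := disc_bounded mono resolvent_locally_bounded r.
have [q q0 Qq] := op_le_ex Q.
exists ((n%:R * q * n%:R) + 1) => [|l l' lr lr'].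
  by rewrite ltr_wpDl// !mulr_ge0// ltW.
have uu : u l - u l' ≈ (l - l') *: (u l * Q * u l').
  have -> : (l - l') *: (u l * Q * u l') =
      u l * (1 - l' *: Q) * u l' - u l * (1 - l *: Q) * u l'.
    have d : (1 - l' *: Q) - (1 - l *: Q) = (l - l') *: Q.
      by rewrite opprB [LHS]addrC addrA subrK scalerBl.
    by rewrite -mulrBl -mulrBr d -bop_scalerAr -bop_scalerAl.
  apply: eqfrB; last first.
    by rewrite -{1}[u l']mul1r; exact/eqfrMr/eqfr_sym/(uP l).2.
  by rewrite -mulrA -{1}[u l]mulr1; exact/eqfrMl/eqfr_sym/(uP l').1.
apply: (ess_le_eqfr uu).
have h : ess_le (u l * Q * u l') (n%:R * q * n%:R).
  apply: ess_leM (un _ lr'); first by rewrite mulr_ge0// ltW.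
  by apply: ess_leM (un _ lr) (op_ess_le Qq).
apply: ess_le_weaken (ess_leZ _ h) _.
by rewrite mulrC ler_wpM2r ?cabs_ge0// lerDl.
Qed.

(** Since [1 - y ^+ 2 = (1 - y) * (1 + y)], the inverse of [1 - y ^+ 2] is the mean
of those of [1 - y] and [1 + y].  With [y = (l *: Q) ^+ n], replacing [l] by [z * l],
where [z ^+ n = -1], changes [y] into [- y]; as [z] has modulus 1, averaging does
not worsen the Lipschitz constant. *)
Lemma power_resolvent_lipschitz (r : R) : exists2 L : R, 0 < L & forall m,
  exists w : K -> bop,
    (forall l, cabs l <= r -> finv (1 - (l *: Q) ^+ (2 ^ m)) (w l)) /\
    (forall l l', cabs l <= r -> cabs l' <= r ->
      ess_le (w l - w l') (L * cabs (l - l'))).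
Proof.
have [L L0 uL] := resolvent_lipschitz r; exists L => //.
elim=> [|m [w [wP wL]]]; first by exists u; split=> // l _; rewrite expn0 expr1.
have [z zE] : exists z : K, z ^+ (2 ^ m) = -1.
  exists ((2 ^ m).-root (-1 : R[i])).
  by rewrite [LHS]rootCK// expn_gt0.
have cz : cabs z = 1.
  apply/eqP; rewrite -(@pexpr_eq1 _ _ (2 ^ m)) ?cabs_ge0 ?expn_gt0//.
  by rewrite -cabsX zE cabsN cabs1.
have zr l : cabs l <= r -> cabs (z * l) <= r by rewrite cabsM cz mul1r.
have twoN0 : (2 : K) != 0 by rewrite pnatr_eq0.
have half : (2^-1 : K) *: (1 + 1 : bop) = 1.
  by rewrite -mulr2n -[X in _ *: X]scaler_nat scalerA mulVf// scale1r.
exists (fun l => 2^-1 *: (w l + w (z * l))); split=> [l lr|l l' lr lr'].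
  have [wy yw] := wP _ lr; have [wz zw] := wP _ (zr _ lr).
  move: wy yw wz zw; set a := w l; set b := w (z * l).
  have -> : ((z * l) *: Q) ^+ (2 ^ m) = - (l *: Q) ^+ (2 ^ m).
    by rewrite -scalerA bop_exprZ zE scaleN1r.
  rewrite expnS mulnC exprM; set y := (_ ^+ (2 ^ m)); rewrite opprK.
  have yE : 1 - y ^+ 2 = (1 - y) * (1 + y).
    by rewrite mulrDr mulr1 mulrBl mul1r -expr2 addrA subrK.
  have yE' : 1 - y ^+ 2 = (1 + y) * (1 - y).
    by rewrite mulrBr mulr1 mulrDl mul1r -expr2 opprD addrA addrK.
  have sum2 : (1 + y) + (1 - y) = 1 + 1 by rewrite addrACA subrr addr0.
  move=> ya ay yb b_y; split.
    rewrite -[X in eqfr _ X]half -bop_scalerAr mulrDr; apply: eqfrZ; rewrite -sum2.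
    apply: eqfrD; first by rewrite yE' -mulrA -{2}[1 + y]mulr1; exact: eqfrMl.
    by rewrite yE -mulrA -{2}[1 - y]mulr1; exact: eqfrMl.
  rewrite -[X in eqfr _ X]half -bop_scalerAl mulrDl; apply: eqfrZ; rewrite -sum2.
  apply: eqfrD; first by rewrite yE mulrA -{2}[1 + y]mul1r; exact: eqfrMr.
  by rewrite yE' mulrA -{2}[1 - y]mul1r; exact: eqfrMr.
rewrite -scalerBr opprD addrACA.
have c2 : cabs (2^-1 : K) = 2^-1.
  rewrite cabsV -[2 in LHS](rmorph_nat (real_complex R)).
  by rewrite [cabs _]cabs_real ger0_norm.
apply: ess_le_weaken (ess_leZ _ (ess_leD (wL _ _ lr lr') (wL _ _ (zr _ lr) (zr _ lr')))) _.
rewrite c2 -mulrBr cabsM cz mul1r; lra.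
Qed.

Definition ess_small (t : R) := forall e : R, 0 < e -> exists m0 : nat,
  forall m, (m0 <= m)%N -> ess_le ((t%:C%C *: Q : bop) ^+ (2 ^ m)) e.

(** If [ys = (s *: Q) ^+ (2 ^ m)] is essentially small then the resolvent [w m s] is
close to 1, hence so is [w m t]; its inverse [1 - yt] is then close enough to 1
for [yt] to have essential norm below 1, and squaring repeatedly makes it small.
With the bounds 1/4 for [ys] and 1/8 for the step, [w m t] is within
1/3 + 1/8 = 11/24 of 1, and [yt] is bounded by (11/24) / (13/24) = 11/13. *)
Lemma ess_small_step (r L s t : R) (w : nat -> K -> bop) :
  (forall m l, cabs l <= r -> finv (1 - (l *: Q) ^+ (2 ^ m)) (w m l)) ->
  (forall m l l', cabs l <= r -> cabs l' <= r ->
      ess_le (w m l - w m l') (L * cabs (l - l'))) ->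
  `|s| <= r -> `|t| <= r -> L * `|t - s| <= 8^-1 -> ess_small s -> ess_small t.
Proof.
move=> wP wL sr tr st ss e e0.
have [|m0 sm] := ss 4^-1; first by rewrite invr_gt0.
have {sm} := sm m0 (leqnn _); set ys := (_ ^+ _) => ysle.
have csr : cabs (s%:C%C : K) <= r by rewrite cabs_real.
have ctr : cabs (t%:C%C : K) <= r by rewrite cabs_real.
have csub : cabs (t%:C%C - s%:C%C : K) = `|t - s|.
  by rewrite -(rmorphB (real_complex R)) cabs_real.
have ws : ess_le (w m0 s%:C%C - 1) (4^-1 / (1 - 4^-1)).
  apply: finv_sub1_le ysle (wP _ _ csr); first by rewrite invr_ge0.
  by rewrite invf_lt1// ltr1n.
pose g := 1 - w m0 t%:C%C.
have gle : ess_le g (11 / 24).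
  have -> : g = - ((w m0 t%:C%C - w m0 s%:C%C) + (w m0 s%:C%C - 1)).
    by rewrite /g addrA subrK opprB.
  apply/ess_leN/(ess_le_weaken (ess_leD (wL _ _ _ ctr csr) ws)).
  have -> : (4^-1 / (1 - 4^-1) : R) = 3^-1 by field.
  by rewrite csub; lra.
pose yt := (t%:C%C *: Q : bop) ^+ (2 ^ m0).
pose q : R := 11 / 13.
have ytle : ess_le yt q.
  have := @finv_sub1_le g (1 - yt) (11 / 24) _ _ gle.
  rewrite addrAC subrr sub0r /g opprB addrC subrK => h.
  rewrite -[yt]opprK; apply: ess_leN; apply: ess_le_weaken (h _ _ _) _.
  - by lra.
  - by lra.
  - exact/finv_sym/wP.
  - by rewrite le_eqVlt /q; apply/orP; left; apply/eqP; field.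
have q0 : 0 <= q by rewrite /q; lra.
have q1 : q < 1 by rewrite /q; lra.
have [k0 qk] := geometric_small q0 q1 e0.
exists (m0 + k0)%N => m mk.
have /subnKC <- : (m0 <= m)%N by exact: leq_trans (leq_addr _ _) mk.
rewrite expnD exprM -/yt; apply: ess_le_weaken (ess_leX _ q0 ytle) _.
apply: le_trans (ltW qk); rewrite ler_wiXn2l// ?ltW//.
apply: (@leq_trans (m - m0)); first by rewrite leq_subRL// (leq_trans _ mk)// leq_addr.
by rewrite ltnW// ltn_expl.
Qed.

(** Move from [0] to [t] in steps short enough for the Lipschitz bound. *)
Lemma ess_small_all (t : R) : 0 <= t -> ess_small t.
Proof.
move=> t0; have [L L0 /choice[w wP]] := power_resolvent_lipschitz t.
pose N := (Num.truncn (8 * L * t)).+1.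
have N0 : 0 < N%:R :> R by rewrite ltr0n.
have step k : (k <= N)%N -> ess_small (k%:R / N%:R * t).
  elim: k => [_|k IH kN].
    rewrite mul0r mul0r => e e0; exists 0%N => m _.
    rewrite [X in X *: _]rmorph0 scale0r expr0n expn_eq0 /=.
    exact: ess_le_weaken ess_le0 (ltW e0).
  have le_t j : (j <= N)%N -> `|j%:R / N%:R * t| <= t.
    move=> jN; rewrite ger0_norm ?mulr_ge0 ?divr_ge0 ?ler0n//.
    by rewrite ler_piMl// ler_pdivrMr// mul1r ler_nat.
  apply: (ess_small_step (fun m => (wP m).1) (fun m => (wP m).2)) (IH (ltnW kN)).
  - exact/le_t/ltnW.
  - exact: le_t.
  have -> : k.+1%:R / N%:R * t - k%:R / N%:R * t = t / N%:R.
    by rewrite -mulrBl -mulrBl -natr1 addrAC subrr add0r mul1r mulrC.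
  rewrite ger0_norm ?divr_ge0 ?ler0n// mulrA ler_pdivrMr//.
  rewrite -ler_pdivrMl ?invr_gt0// invrK mulrA.
  by rewrite ltW// truncnS_gt.
by have := step N (leqnn _); rewrite divff ?mul1r// gt_eqF.
Qed.

End Resolvent.

(** Riesz operators, with Atkinson's form of the Fredholm property. *)
Definition fred_riesz Q := forall m : K, m != 0 -> finvertible (Q - m *: (1 : bop)).

Lemma fred_riesz_resolvent Q (l : K) : fred_riesz Q -> finvertible (1 - l *: Q).
Proof.
move=> rQ; have [->|l0] := eqVneq l 0.
  by rewrite scale0r subr0; exists 1; split; rewrite mulr1; exact: eqfr_refl.
have -> : 1 - l *: Q = - l *: (Q - l^-1 *: (1 : bop)).
  by rewrite scalerBr scalerA mulNr divff// !scaleNr scale1r opprK addrC.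
by apply: finvertibleZ; rewrite ?oppr_eq0//; apply: rQ; rewrite invr_eq0.
Qed.

Lemma eqfr_commX A B n : A * B ≈ B * A -> A * B ^+ n ≈ B ^+ n * A.
Proof.
move=> AB; elim: n => [|n IH]; first by rewrite expr0 mulr1 mul1r; exact: eqfr_refl.
rewrite exprS mulrA -mulrA; apply: (eqfr_trans (B := B * A * B ^+ n)).
  by rewrite mulrA; exact: eqfrMr.
by rewrite -!mulrA; exact: eqfrMl.
Qed.

Lemma eqfr_exprM A B n : A * B ≈ B * A -> (A * B) ^+ n ≈ A ^+ n * B ^+ n.
Proof.
move=> AB; elim: n => [|n IH]; first by rewrite !expr0 mulr1; exact: eqfr_refl.
rewrite !exprS; apply: (eqfr_trans (eqfrMl _ IH)).
rewrite -!mulrA; apply: eqfrMl; rewrite !mulrA; apply: eqfrMr.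
by apply: eqfr_commX; exact: eqfr_sym.
Qed.

(** Powers of [B * Q] are essentially small, so that [1 - (B * Q) ^+ n], and
hence its factor [1 - B * Q], is invertible modulo finite rank. *)
Lemma fred_riesz_finvertible Q B : fred_riesz Q -> B * Q ≈ Q * B ->
  finvertible (1 - B * Q).
Proof.
move=> rQ BQ; have [b b0 Bb] := op_le_ex B.
have /choice[u uP] := fun l => fred_riesz_resolvent l rQ.
have [|m sm] := ess_small_all uP (ltW b0) (e := 2^-1); first by rewrite invr_gt0.
have {sm} := sm m (leqnn _); set n := (2 ^ m)%N => Qn.
pose c : K := b%:C%C.
have cb : cabs c = b by rewrite cabs_real ger0_norm// ltW.
have c0 : c != 0 by apply/eqP => c0; move: cb; rewrite c0 cabs0 => b00; rewrite -b00 ltxx in b0.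
have Bn : op_le ((c^-1 *: B) ^+ n) 1.
  rewrite -[1 in X in op_le _ X](expr1n _ n); apply: op_leX => //.
  have := op_leZ c^-1 Bb; rewrite cabsV cb mulVf//; exact: lt0r_neq0.
have Kn : ess_le ((B * Q) ^+ n) 2^-1.
  apply: (ess_le_eqfr (eqfr_exprM n BQ)).
  have -> : B ^+ n * Q ^+ n = (c^-1 *: B) ^+ n * (c *: Q) ^+ n.
    rewrite !bop_exprZ -bop_scalerAl -bop_scalerAr scalerA -exprMn.
    by rewrite mulVf// expr1n scale1r.
  by have := ess_leM ler01 (op_ess_le Bn) Qn; rewrite mul1r.
have h0 : 0 <= 2^-1 :> R by rewrite invr_ge0.
have h1 : 2^-1 < 1 :> R by rewrite invf_lt1// ltr1n.
have [V [KV VK] _] := weyl_dec_finv (ess_le_weyl_dec h0 h1 Kn).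
set A := B * Q in KV VK *; pose S := \sum_(i < n) A ^+ i.
have AS : 1 - A ^+ n = (1 - A) * S by rewrite -opprB subrX1 -mulNr opprB.
have SA : 1 - A ^+ n = S * (1 - A).
  rewrite AS; apply: commr_sum => i _; apply/commr_sym/commrB.
    exact: commr1.
  exact/commr_sym/commrX.
apply: (@finvertible_lr _ _ _ (V * S) (S * V)).
  by rewrite -mulrA -SA.
by rewrite mulrA -AS.
Qed.

Lemma fred_rieszM Q B : fred_riesz Q -> B * Q ≈ Q * B -> fred_riesz (B * Q).
Proof.
move=> rQ BQ m m0.
have -> : B * Q - m *: (1 : bop) = - m *: (1 - (m^-1 *: B) * Q).
  rewrite scalerBr -bop_scalerAl scalerA mulNr divff// !scaleNr scale1r opprK.
  by rewrite addrC.
apply: finvertibleZ; rewrite ?oppr_eq0//; apply: fred_riesz_finvertible => //.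
by rewrite -bop_scalerAl -bop_scalerAr; exact: eqfrZ.
Qed.

End QuasiNilpotent.

(** * Browder operators *)

Section Browder.
Variables (R : realType) (X : completeNormedModType (Cplx R)).
Local Notation K := (Cplx R).
Local Notation bop := (bop X).
Implicit Types (A B C F J P Q S U W : bop) (x y : X).

Lemma weyl_dec_dims A : weyl_dec A ->
  exists n, has_dim (null_space A) n /\ has_codim (range A) n.
Proof.
move=> /weyl_of_weyl_dec[[[n hn] [m hm]]]; rewrite /fredholm_index (dimE hn).
rewrite (codimE (subspace_range A) hm) => /eqP; rewrite subr_eq0 => /eqP[nm].
by exists n; split=> //; rewrite nm.
Qed.

Lemma null_exp_sub A n m : (n <= m)%N ->
  null_space (A ^+ n) `<=` null_space (A ^+ m).
Proof.
move=> /subnK <- x; rewrite /null_space /= => Ax.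
by rewrite exprD bopME Ax bopr0.
Qed.

Lemma range_exp_sub A n m : (n <= m)%N -> range (A ^+ m) `<=` range (A ^+ n).
Proof.
by move=> /subnKC <- _ [x _ <-]; exists ((A ^+ (m - n)) x); rewrite // exprD bopME.
Qed.

Lemma null_exp_stable A p m : (p <= m)%N ->
  null_space (A ^+ p) = null_space (A ^+ p.+1) ->
  null_space (A ^+ m) = null_space (A ^+ p).
Proof.
move=> pm Np; apply/seteqP; split; last exact: null_exp_sub.
rewrite -(subnK pm); elim: (m - p)%N => [|k IH]; first by rewrite add0n.
move=> x kx; apply: IH.
have : null_space (A ^+ p.+1) ((A ^+ k) x).
  by rewrite /null_space /= -bopME -exprD addnC addnS -addSn.
by rewrite -Np /null_space /= -bopME -exprD addnC.
Qed.

Lemma range_exp_stable A q m : (q <= m)%N ->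
  range (A ^+ q) = range (A ^+ q.+1) -> range (A ^+ m) = range (A ^+ q).
Proof.
move=> qm Rq; apply/seteqP; split; first exact: range_exp_sub.
rewrite -(subnK qm); elim: (m - q)%N => [|k IH]; first by rewrite add0n.
move=> y /IH[x _ <-].
have : range (A ^+ q) ((A ^+ q) x) by exists x.
rewrite Rq => -[z _ zE]; exists z => //.
by rewrite [in RHS]exprD bopME -zE -bopME -exprD addSnnS.
Qed.

(** The powers of [A] are Weyl, so the codimensions of their ranges are the
dimensions of their kernels and stabilize with them. *)
Lemma weyl_dec_descent A p : weyl_dec A ->
  null_space (A ^+ p) = null_space (A ^+ p.+1) ->
  range (A ^+ p) = range (A ^+ p.+1).
Proof.
move=> wA Np; have [n [hn hr]] := weyl_dec_dims (weyl_decX p wA).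
have [m [hm hr']] := weyl_dec_dims (weyl_decX p.+1 wA).
have nm : n = m by rewrite -(dimE hn) Np (dimE hm).
rewrite -nm in hr'; apply/esym.
apply: has_codim_sub_eq hr' hr; first exact: subspace_range.
  exact: subspace_range.
exact: range_exp_sub.
Qed.

(** For operators of finite ascent and descent a finite-dimensional kernel already
implies the Fredholm property; see [browder_projection]. *)
Definition browder A := [/\ finite_dim (null_space A),
  exists p, null_space (A ^+ p) = null_space (A ^+ p.+1)
& exists q, range (A ^+ q) = range (A ^+ q.+1)].

Lemma weyl_dec_browder A p : weyl_dec A ->
  null_space (A ^+ p) = null_space (A ^+ p.+1) -> browder A.
Proof.
move=> wA Np; split; [exact: weyl_dec_null_finite|by exists p|].
by exists p; exact: weyl_dec_descent.
Qed.

Lemma invertible_browder A : invertible A -> browder A.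
Proof.
move=> iA; apply: (@weyl_dec_browder A 0%N); first exact: invertible_weyl_dec.
have [B [_ BA]] := iA; apply/seteqP; split; first exact: null_exp_sub.
move=> x; rewrite /null_space /= expr0 expr1 bop1E => Ax.
by rewrite -[x]bop1E -BA bopME Ax bopr0.
Qed.

Lemma preimage_finite_dim A (V : set X) : subspace V -> finite_dim V ->
  finite_dim (null_space A) -> finite_dim [set x | V (A x)].
Proof.
move=> sV [n [e [Ve ie se]]] [k [w bw]]; have [_ sw] := set0_quotient_basis bw.
have [m [v [Vv _ sv]]] : exists m (v : 'I_m -> X),
    quotient_basis (V `&` range A) [set 0] v.
  apply: (@quotient_basis_ex _ _ _ _ _ e (subspace_set0 X)).
  by move=> x [Vx _]; exact: se.
have /choice[u uE] : forall i, exists u, A u = v i.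
  by move=> i; have [_ [u _ uE]] := Vv i; exists u.
apply: (@finite_dimP _ _ _ (m + k)%N
  (fun i => match fintype.split i with inl j => u j | inr j => w j end)).
move=> x /= VAx; have [|c /subr0_eq cE] := sv (A x); first by split=> //; exists x.
have [|d dE] := sw (x - \sum_i c i *: u i).
  rewrite /null_space /= boprB cE bopr_sum; apply/eqP; rewrite subr_eq0; apply/eqP.
  by apply: eq_bigr => i _; rewrite boprZ uE.
exists (fun i => match fintype.split i with inl j => c j | inr j => d j end).
rewrite big_split_ord /= -[LHS](subrK (\sum_i c i *: u i)) dE [LHS]addrC.
congr (_ + _); apply: eq_bigr => i _.
  by rewrite (unsplitK (inl i)).
by rewrite (unsplitK (inr i)).
Qed.

Lemma null_exp_finite_dim A n : finite_dim (null_space A) ->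
  finite_dim (null_space (A ^+ n)).
Proof.
move=> fA; elim: n => [|n IH].
  exists 0%N, (fun=> 0); split=> [[]//|c _ []//|x].
  by rewrite /null_space /= expr0 bop1E => ->; exists (fun=> 0); rewrite big_ord0 subr0.
have -> : null_space (A ^+ n.+1) = [set x | null_space (A ^+ n) (A x)].
  by apply/seteqP; split=> x; rewrite /null_space /= exprSr bopME.
by apply: preimage_finite_dim => //; exact: subspace_null.
Qed.

(** The spectral projection at [0], without contour integrals: beyond the ascent and
descent, [X] is the direct sum of [null_space (A ^+ m)] and [range (A ^+ m)], and
[P] projects onto the former along the latter.  It is bounded because
[D = 1 - S * U], for a generalized inverse [U] of [S = A ^+ m], is a bounded
projection along [range S]; composing [D] with functionals dual to the images under
[D] of a basis of [null_space S] gives [P].  Both summands are invariant under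
everything that commutes with [A], and [A + P] is bijective on each. *)
Lemma browder_projection A : browder A -> exists P m,
  [/\ finite_rank P, P * P = P, A ^+ m * P = 0,
      forall C, GRing.comm C A -> GRing.comm C P & invertible (A + P)].
Proof.
move=> [fN [p Np] [q Rq]]; pose m := (maxn p q).+1.
have pm : (p <= m)%N by rewrite ltnW// ltnS leq_maxl.
have qm : (q <= m)%N by rewrite ltnW// ltnS leq_maxr.
set S := A ^+ m.
have NS x : S (S x) = 0 -> S x = 0.
  move=> SSx; have : null_space (A ^+ (m + m)) x by rewrite /null_space /= exprD bopME.
  rewrite (null_exp_stable (leq_trans pm (leq_addr _ _)) Np).
  by rewrite -(null_exp_stable pm Np).
have RS x : exists z, S x = S (S z).
  have : range S (S x) by exists x.
  rewrite /S (range_exp_stable qm Rq) -(range_exp_stable (leq_trans qm (leq_addr m _)) Rq).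
  by move=> [z _ <-]; exists z; rewrite -[in RHS]bopME -exprD.
have RS1 x : exists z, S x = A (S z).
  have : range S (S x) by exists x.
  rewrite /S (range_exp_stable qm Rq) -(range_exp_stable (leq_trans qm (leqnSn m)) Rq).
  by move=> [z _ <-]; exists z; rewrite exprS bopME.
have dec x : exists n z, x = n + S z /\ S n = 0.
  have [z Sz] := RS x; exists (x - S z), z.
  by rewrite subrK boprB Sz subrr.
have [k [e be]] := null_exp_finite_dim m fN.
have [ie se] := set0_quotient_basis be.
have Se i : S (e i) = 0 by case: be => Ve _ _; exact: Ve.
have [|U [SUS _ _]] := @fredholm_generalized_inverse _ _ S.
  split; exists k, e => //; split=> //.
    move=> c [x _ xE]; apply: ie; rewrite -xE; apply: NS.
    by rewrite xE bopr_sum big1// => i _; rewrite boprZ Se scaler0.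
  move=> x _; have [n [z [-> Sn]]] := dec x.
  have [c ->] := se n Sn; exists c; exists z => //.
  by rewrite addrAC subrr add0r.
pose D := 1 - S * U.
have DS x : D (S x) = 0 by rewrite -bopME mulrBl mul1r SUS subrr bop0E.
have iD (c : 'I_k -> K) : \sum_i c i *: D (e i) = 0 -> forall i, c i = 0.
  move=> cD; apply: ie.
  have : D (\sum_i c i *: e i) = 0.
    by rewrite bopr_sum -[RHS]cD; apply: eq_bigr => i _; rewrite boprZ.
  rewrite /D bopBE bop1E bopME => /subr0_eq eS; rewrite eS; apply: NS; rewrite -eS.
  by rewrite bopr_sum big1// => i _; rewrite boprZ Se scaler0.
have [g [bg ge]] := hahn_banach_family iD.
have bgD i : bounded_functional (fun x => g i (D x)).
  have [sg [M gM]] := bg i; split=> [a x y|].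
    by rewrite boprD boprZ sg.
  have [d d0 Dd] := op_le_ex D; exists (`|M| * d) => x.
  rewrite (le_trans (gM _))// -mulrA (le_trans (ler_wpM2r (nrm_ge0 _) (ler_norm M)))//.
  by rewrite ler_wpM2l.
have [P PE] := finite_rank_bop e bgD.
have PS x : P (S x) = 0.
  by rewrite PE big1// => i _; rewrite DS bounded_functional0// scale0r.
have Pn n : S n = 0 -> P n = n.
  move=> /se[c ->]; rewrite PE; apply: eq_bigr => i _; congr (_ *: _).
  rewrite -[\sum_j _]add0r (biorthogonal_sum (e := e) _ _ _ bgD)//.
  by rewrite bopr0 bounded_functional0// add0r.
have SP x : S (P x) = 0.
  by rewrite PE bopr_sum big1// => i _; rewrite boprZ Se scaler0.
have decP x : exists z, x = P x + S z.
  have [n [z [xE Sn]]] := dec x; exists z.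
  by rewrite {2}xE boprD PS addr0 Pn.
have PC C : GRing.comm C A -> GRing.comm C P.
  move=> CA; have CS y : C (S y) = S (C y).
    by rewrite -!bopME; congr (bop_lin _ y); exact: commrX.
  apply: bopP => x; rewrite !bopME; have [z {2}->] := decP x.
  by rewrite boprD CS boprD PS addr0 [RHS]Pn// -CS SP bopr0.
exists P, m; split=> //.
- exact: finite_rank_sum PE.
- by apply: bopP => x; rewrite bopME Pn.
- by apply: bopP => x; rewrite bopME SP bop0E.
have AP x : A (P x) = P (A x).
  by rewrite -!bopME; congr (bop_lin _ x); exact: PC.
apply: bijective_invertible => [x|y].
  rewrite bopDE => xE.
  have Ax : A (P x) = - P x.
    apply/eqP; rewrite -addr_eq0 AP -[X in _ + X == _](Pn _ (SP x)) -boprD xE; exact/eqP/bopr0.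
  have Px : P x = 0.
    have Ak j : (A ^+ j) (P x) = (-1) ^+ j *: P x.
      elim: j => [|j IH]; first by rewrite !expr0 bop1E scale1r.
      by rewrite exprS bopME IH boprZ Ax scalerN exprS mulN1r scaleNr.
    have := SP x; rewrite /S Ak => /eqP; rewrite scaler_eq0 signr_eq0 => /eqP//.
  move: xE; rewrite Px addr0 => Ax0.
  by rewrite -Px Pn// /S exprSr bopME Ax0 bopr0.
have [z yE] := decP y; have [z' zE] := RS1 z.
pose V := \sum_(j < m) (- A) ^+ j.
have AV : (A + 1) * V = 1 - (- A) ^+ m.
  by rewrite -opprB subrX1 -mulNr opprB opprK addrC.
have VS x : S (V x) = V (S x).
  rewrite -!bopME; congr (bop_lin _ x); apply: commr_sum => j _.
  by apply/commrX/commrN/commr_sym/commrX.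
have PV : P (V (P y)) = V (P y) by rewrite Pn// VS SP bopr0.
exists (V (P y) + S z'); rewrite bopDE !boprD PV PS addr0 -zE addrAC.
have -> : A (V (P y)) + V (P y) = P y.
  rewrite -[X in _ + X]bop1E -bopDE -bopME AV bopBE bop1E exprNn bopME SP.
  by rewrite bopr0 subr0.
by rewrite -yE.
Qed.

End Browder.

(** * Commuting Riesz perturbations *)

Section Perturbation.
Variables (R : realType) (X : completeNormedModType (Cplx R)).
Local Notation K := (Cplx R).
Local Notation bop := (bop X).
Implicit Types (A B C F J P Q S T U W : bop) (x y : X) (m : K).

Lemma scalar_comm A m : GRing.comm A (m *: (1 : bop)).
Proof. by rewrite /GRing.comm -bop_scalerAl -bop_scalerAr mulr1 mul1r. Qed.

Lemma invertible_shift_small J : invertible J ->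
  exists2 e : R, 0 < e & forall m, cabs m < e -> invertible (J - m *: (1 : bop)).
Proof.
move=> [J' [JJ' J'J]]; have [c c0 J'c] := op_le_ex J'.
exists c^-1 => [|m mc]; first by rewrite invr_gt0.
have -> : J - m *: (1 : bop) = J * (1 - m *: J').
  by rewrite mulrBr mulr1 -bop_scalerAr JJ'.
apply: invertibleM; first by exists J'.
have mc0 : 0 <= cabs m * c by rewrite mulr_ge0 ?cabs_ge0// ltW.
have mc1 : cabs m * c < 1 by rewrite -ltr_pdivlMr// div1r.
by have [B] := neumann mc0 mc1 (op_leZ m J'c); exists B.
Qed.

(** Off its spectral projection [P], a Browder operator coincides with the
invertible [A + P]; on the range of [P] it is nilpotent. *)
Lemma browder_punctured A : browder A ->
  weyl_dec A /\ exists2 e : R, 0 < e & forall m, m != 0 -> cabs m < e ->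
    invertible (A - m *: (1 : bop)).
Proof.
move=> /browder_projection[P [n [fP PP AnP PC iJ]]].
have AE : A = (A + P) - P by rewrite addrK.
have AP : P * A = A * P by rewrite PC.
have wA m : A - m *: (1 : bop) ≈ (A + P) - m *: (1 : bop).
  apply: eqfrB (eqfr_refl _); rewrite /eqfr opprD addrA subrr sub0r.
  exact: finite_rankN.
split; first by exists (A + P); split=> //; have := wA 0; rewrite !scale0r !subr0.
have [e e0 Je] := invertible_shift_small iJ; exists e => // m m0 me.
have [N [_ NJ]] := Je m me.
apply: weyl_dec_inj_invertible.
  by exists (A + P - m *: (1 : bop)); split; [exact: Je|exact: wA].
move=> x; rewrite bopBE bopZE bop1E => /subr0_eq Ax.
have xP : x = P x.
  apply/eqP; rewrite -subr_eq0 -[x - _]bop1E -NJ bopME; apply/eqP.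
  rewrite [X in N X](_ : _ = 0) ?bopr0//.
  rewrite bopBE bopZE bop1E bopDE !boprB -[P (P x)]bopME PP subrr addr0.
  rewrite -[A (P x)]bopME -AP bopME Ax boprZ scalerBr; exact: subrr.
have Anx k : (A ^+ k) x = m ^+ k *: x.
  elim: k => [|k IH]; first by rewrite !expr0 bop1E scale1r.
  by rewrite exprS bopME IH boprZ Ax scalerA -exprSr.
have := Anx n; rewrite {1}xP -bopME AnP bop0E => /esym/eqP.
by rewrite scaler_eq0 expf_eq0 (negbTE m0) andbF => /eqP.
Qed.

(** In the notation of the proof, [Y] is the intersection of the ranges of the powers
of [A] and [V n0] is the eventual value of [null_space A `&` range (A ^+ n)], which is
nonzero as the ascent is infinite.  If [y] is in [Y], any preimage of [y] under [A]
that lies in [range (A ^+ n0)] is again in [Y]; such a preimage is [W y] for the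
bounded operator [W = A ^+ n0 * U], where [U] is a generalized inverse of
[A ^+ n0.+1].  Starting from [x0] in [V n0], the vector
[x = (1 - m *: W)^-1 x0], that is the sum of the [m ^+ k *: (W ^+ k) x0], satisfies
[A x = m *: x]. *)
Lemma weyl_dec_shift_null A : weyl_dec A ->
  (forall p, null_space (A ^+ p) <> null_space (A ^+ p.+1)) ->
  exists2 e : R, 0 < e & forall m, cabs m < e -> exists2 x, x != 0 & A x = m *: x.
Proof.
move=> wA asc.
pose V n := null_space A `&` range (A ^+ n).
have sV n : subspace (V n).
  split=> [|a x y [Nx Rx] [Ny Ry]].
    by split; [case: (subspace_null A)|case: (subspace_range (A ^+ n))].
  by split; [apply: (subspace_null A).2|apply: (subspace_range (A ^+ n)).2].
have Vdec n : V n.+1 `<=` V n.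
  by move=> x [Nx Rx]; split=> //; exact: range_exp_sub (leqnSn n) _ Rx.
have [|n0 Vn0] := nonincreasing_stable sV Vdec.
  have [k [e be]] := weyl_dec_null_finite wA.
  have [_ se] := set0_quotient_basis be.
  by apply: (finite_dimP (v := e)) => x [Nx _]; exact: se.
have [x0 x00 Vx0] : exists2 x0, x0 != 0 & V n0 x0.
  have [y Ny Ny'] : exists2 y, null_space (A ^+ n0.+1) y & ~ null_space (A ^+ n0) y.
    apply: contrapT => nex; apply: (asc n0); apply/seteqP.
    split; first exact: null_exp_sub.
    by move=> y Ny; apply: contrapT => Ny'; apply: nex; exists y.
  exists ((A ^+ n0) y); first by apply/eqP.
  split; last by exists y.
  by rewrite /null_space /= -bopME -exprS.
set B := A ^+ n0.+1.
have [|U [BUB _ _]] := @fredholm_generalized_inverse _ _ B.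
  by case: (weyl_of_weyl_dec (weyl_decX n0.+1 wA)).
pose W := A ^+ n0 * U.
have AW : A * W = B * U by rewrite /W mulrA -exprS.
pose Y := [set y | forall n, range (A ^+ n) y].
have AWY y : Y y -> A (W y) = y.
  move=> /(_ n0.+1)[z _ <-].
  by rewrite -bopME AW -bopME BUB.
have WY y : Y y -> Y (W y).
  move=> Yy n; have [n0n|nn0] := leqP n0 n; last first.
    apply: range_exp_sub (ltnW nn0) _ _; exists (U y) => //.
    by rewrite -bopME.
  have [z _ zE] := Yy n.+1.
  have Vd : V n0 (W y - (A ^+ n) z).
    split; first by rewrite /null_space /= boprB AWY// -bopME -exprS zE subrr.
    apply: subspaceB; first exact: subspace_range.
      by exists (U y) => //; rewrite -bopME.
    by apply: range_exp_sub n0n _ _; exists z.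
  rewrite -(Vn0 n n0n) in Vd; have [_ Rd] := Vd.
  rewrite -[W y](subrK ((A ^+ n) z)); apply: (subspaceD (subspace_range (A ^+ n)) Rd).
  by exists z.
have Yx0 : Y x0.
  move=> n; have [n0n|nn0] := leqP n0 n.
    by move: Vx0; rewrite -(Vn0 n n0n) => -[].
  by apply: range_exp_sub (ltnW nn0) _ _; case: Vx0.
have YWk k : Y ((W ^+ k) x0).
  by elim: k => [|k IH]; rewrite ?expr0 ?bop1E// exprS bopME; exact: WY.
have [w w0 Ww] := op_le_ex W; have [d d0 Dd] := op_le_ex (1 - A * W).
exists w^-1 => [|m mw]; first by rewrite invr_gt0.
have mw0 : 0 <= cabs m * w by rewrite mulr_ge0 ?cabs_ge0// ltW.
have mw1 : cabs m * w < 1 by rewrite -ltr_pdivlMr// div1r.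
have [N [WN NW] _] := neumann mw0 mw1 (op_leZ m Ww).
pose x := N x0.
have xE : x = x0 + m *: W x.
  have : (1 - m *: W) x = x0 by rewrite -bopME WN bop1E.
  by rewrite bopBE bop1E bopZE => <-; rewrite subrK.
have xN0 : x != 0.
  by apply: contra x00 => /eqP x_0; move: xE; rewrite x_0 bopr0 scaler0 addr0 => /esym/eqP.
exists x => //.
(* [A * W] fixes [Y] pointwise; it fixes [x] as well, since [1 - A * W] kills the
   partial sums of the series for [x]. *)
have Dk k : (1 - A * W) x = m ^+ k *: (1 - A * W) ((W ^+ k) x).
  elim: k => [|k IH]; first by rewrite !expr0 scale1r bop1E.
  rewrite IH {1}xE boprD boprD (_ : (1 - A * W) ((W ^+ k) x0) = 0); last first.
    by rewrite bopBE bop1E bopME AWY ?subrr.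
  by rewrite add0r !boprZ scalerA -exprSr -[(W ^+ k) (W x)]bopME -exprSr.
have D0 : (1 - A * W) x = 0.
  apply: nrm_eq0; apply/eqP; rewrite eq_le nrm_ge0 andbT.
  apply: (@le_geometric0 _ (cabs m * w) _ (d * nrm x)) => // k.
  rewrite (Dk k) nrmZ cabsX exprMn -mulrA ler_wpM2l ?exprn_ge0 ?cabs_ge0//.
  rewrite mulrCA (le_trans (Dd _))//; apply: ler_wpM2l; first exact: ltW.
  exact: op_leX (ltW w0) Ww _.
have AWx : A (W x) = x by move: D0; rewrite bopBE bop1E bopME => /subr0_eq.
rewrite {1}xE boprD boprZ AWx.
by have [-> _] := Vx0; rewrite add0r.
Qed.

(** With infinite ascent all small shifts would fail to be injective; and for a Weyl
operator finite ascent implies finite descent. *)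
Lemma weyl_dec_isolated_browder A : weyl_dec A ->
  (forall e : R, 0 < e -> exists2 m, cabs m < e & forall x, A x = m *: x -> x = 0) ->
  browder A.
Proof.
move=> wA inj; apply: contrapT => nbA.
have [[p /(weyl_dec_browder wA)/nbA//]|/forallNP asc] :=
  pselect (exists p, null_space (A ^+ p) = null_space (A ^+ p.+1)).
have [e e0 Ae] := weyl_dec_shift_null wA asc.
have [m me minj] := inj e e0; have [x /eqP x0 /minj] := Ae m me.
by move=> /x0.
Qed.

(** If [U] is an essential inverse of [S], then [U * (S - m)] is Weyl for small [m];
choosing [S - m] invertible shows that [U], and then [S], is Weyl. *)
Lemma finvertible_limit_browder S : finvertible S ->
  (forall e : R, 0 < e -> exists2 m, cabs m < e & invertible (S - m *: (1 : bop))) ->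
  browder S.
Proof.
move=> [U [SU US]] lim; have [u u0 Uu] := op_le_ex U.
have [|m mu iSm] := lim u^-1; first by rewrite invr_gt0.
have mu0 : 0 <= cabs m * u by rewrite mulr_ge0 ?cabs_ge0// ltW.
have mu1 : cabs m * u < 1 by rewrite -ltr_pdivlMr// div1r.
have wUS : weyl_dec (U * (S - m *: (1 : bop))).
  apply: (@eqfr_weyl_dec _ _ _ (1 - m *: U)).
    by rewrite mulrBr -bop_scalerAr mulr1; apply: eqfrB US (eqfr_refl _).
  by apply: ess_le_weyl_dec mu0 mu1 _; exact/op_ess_le/op_leZ.
have wU := weyl_dec_cancelr (invertible_weyl_dec iSm) wUS.
have wS : weyl_dec S.
  apply: weyl_dec_cancell wU _; apply: eqfr_weyl_dec US _.
  exact/invertible_weyl_dec/invertible1.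
apply: weyl_dec_isolated_browder wS _ => e e0; have [m' m'e iS] := lim e e0.
exists m' => // x Sx; have [N [_ NS]] := iS.
by rewrite -[x]bop1E -NS bopME bopBE bopZE bop1E Sx subrr bopr0.
Qed.

(** Otherwise let [s] be the supremum of the [t >= 1] such that [Q - t] is not Browder;
it is finite since [Q - t] is invertible for large [t].  If [Q - s] were Browder, then
[Q - t] would be invertible for [t] near [s]; if it is not, then [Q - s] is still a
limit of invertible operators, as [Q - t] is Browder for [t > s]. *)
Lemma fred_riesz_browder Q : fred_riesz Q -> browder (Q - 1).
Proof.
move=> rQ; pose S (t : R) := Q - t%:C%C *: (1 : bop).
have shift (t s : R) : S t - (s - t)%:C%C *: (1 : bop) = S s.
  by rewrite /S -addrA -opprD -scalerDl -(rmorphD (real_complex R)) /= [t + _]addrC subrK.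
have [q q0 Qq] := op_le_ex Q.
have big t : q < t -> browder (S t).
  move=> qt; have t0 : 0 < t by exact: lt_trans qt.
  apply: invertible_browder.
  have tN0 : t%:C%C != 0 :> K.
    by apply/eqP => /complexI t_0; rewrite t_0 ltxx in t0.
  have -> : S t = - t%:C%C *: (1 - (t%:C%C)^-1 *: Q).
    by rewrite scalerBr scalerA mulNr divff// !scaleNr scale1r opprK addrC.
  apply: invertibleZ; first by rewrite oppr_eq0.
  have ct : cabs ((t%:C%C)^-1 : K) = t^-1.
    by rewrite cabsV cabs_real ger0_norm// ltW.
  have h0 : 0 <= t^-1 * q by rewrite mulr_ge0 ?invr_ge0 ?ltW.
  have h1 : t^-1 * q < 1 by rewrite mulrC ltr_pdivrMr// mul1r.
  have := op_leZ (t%:C%C)^-1 Qq; rewrite ct => /(neumann h0 h1)[B iB _].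
  by exists B.
apply: contrapT => nb1; pose E := [set t : R | 1 <= t /\ ~ browder (S t)].
have E1 : E 1 by split=> //; rewrite /S [X in X *: _]rmorph1 scale1r.
have Eub : ubound E q.
  by move=> t [_ nb]; rewrite leNgt; apply: (contra_notN _ nb) => /big.
have supE : has_sup E by split; [exists 1|exists q].
pose s := sup E.
have s1 : 1 <= s by apply: ub_le_sup => //; exists q.
have sN0 : s%:C%C != 0 :> K.
  by apply/eqP => /complexI s_0; rewrite s_0 in s1; lra.
have [bs|nbs] := pselect (browder (S s)).
  have [_ [e e0 Se]] := browder_punctured bs.
  have [t [t1 nbt] st] := sup_adherent e0 supE.
  have ts : t <= s by apply: ub_le_sup => //; exists q.
  apply: nbt; have [->//|tNs] := eqVneq t s.
  apply: invertible_browder; rewrite -(shift s t); apply: Se.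
    by apply/eqP => /complexI /eqP; rewrite subr_eq0 (negbTE tNs).
  by rewrite cabs_real ler0_norm ?opprB; rewrite -/s in st; lra.
apply: nbs; apply: finvertible_limit_browder; first exact: rQ.
move=> e e0; pose t := s + e / 2.
have bt : browder (S t).
  apply: contrapT => nbt; have : t <= s.
    apply: ub_le_sup; first by exists q.
    by split=> //; rewrite /t; lra.
  rewrite /t; lra.
have [_ [d d0 Sd]] := browder_punctured bt.
pose h := Num.min (d / 2) (e / 4).
have h0 : 0 < h by rewrite lt_min !divr_gt0.
have hd : h <= d / 2 by rewrite ge_min lexx.
have he : h <= e / 4 by rewrite ge_min lexx orbT.
exists ((t + h - s)%:C%C : K); first by rewrite cabs_real /t ger0_norm; lra.
rewrite shift -(shift t); apply: Sd.
  by apply/eqP => /complexI; lra.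
by rewrite cabs_real ger0_norm; lra.
Qed.

Lemma fred_riesz_weyl_dec Q : fred_riesz Q -> weyl_dec (1 - Q).
Proof.
move=> /fred_riesz_browder/browder_punctured[wQ _].
rewrite -opprB -mulN1r; apply: weyl_decM wQ; apply: invertible_weyl_dec.
by exists (-1); split; rewrite mulrNN mulr1.
Qed.

(** Converse to [browder_projection]: the kernels of all powers of [A] lie in the
range of [F], because [1 - (J^-1 * A) ^+ k] is a multiple of [F]. *)
Lemma comm_decomposition_browder A J F : A = J + F -> invertible J ->
  finite_rank F -> GRing.comm J F -> browder A.
Proof.
move=> AE iJ fF JF; have [J' [JJ' J'J]] := iJ; have [n [v Fv]] := fF.
have wA : weyl_dec A.
  by exists J; split=> //; rewrite AE /eqfr addrC addrA addNr add0r.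
have J'F : GRing.comm F J'.
  by rewrite /GRing.comm -[F * J']mul1r -J'J -!mulrA (mulrA J) JF -mulrA JJ' mulr1.
have J'A : 1 - J' * A = - (F * J') by rewrite AE mulrDr J'J opprD addrA subrr sub0r J'F.
have AJ' : GRing.comm A J'.
  by rewrite AE; apply/commr_sym/commrD; [rewrite /GRing.comm JJ'|exact: commr_sym].
have [|||k Nk] := @nondecreasing_stable _ _ (fun k => null_space (A ^+ k)) n v.
- by move=> k; exact: subspace_null.
- by move=> k; exact: null_exp_sub.
- move=> k x Akx.
  have : (1 - (J' * A) ^+ k) x = x.
    rewrite bopBE bop1E exprMn_comm; last exact: commr_sym.
    by rewrite bopME Akx bopr0 subr0.
  move=> <-; have -> : 1 - (J' * A) ^+ k = F * (- (J' * \sum_(i < k) (J' * A) ^+ i)).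
    by rewrite -opprB subrX1 -mulNr opprB J'A mulNr mulrN mulrA.
  by rewrite bopME; exact: Fv.
- exact: weyl_dec_browder Nk.
Qed.

(** Write [S = J - P] with the spectral projection [P], and
[J + Q = J * (1 + J^-1 * Q)].  Here [J^-1 * Q] is again Riesz, so that the second factor
is [- (J1 - P1)] with a spectral projection [P1].  All these operators commute, and
[S + Q] is the sum of the invertible [- (J * J1)] and the finite-rank
[J * P1 - P]. *)
Lemma browder_perturbation S Q : fred_riesz Q -> GRing.comm S Q ->
  browder S -> browder (S + Q).
Proof.
move=> rQ SQ bS; have [P [_ [fP _ _ PC iJ]]] := browder_projection bS.
set J := S + P in iJ; have [J' [JJ' J'J]] := iJ.
have inv_comm C : GRing.comm C J -> GRing.comm C J'.
  move=> CJ; rewrite /GRing.comm -[C * J']mul1r -J'J -!mulrA (mulrA J) -CJ -mulrA.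
  by rewrite JJ' mulr1.
have QS : GRing.comm Q S by exact: commr_sym.
have QP : GRing.comm Q P by exact: PC.
have QJ : GRing.comm Q J by exact: commrD.
have PS : GRing.comm P S by apply/commr_sym/PC/commr_refl.
have PJ : GRing.comm P J by apply: commrD => //; exact: commr_refl.
have QJ' := inv_comm _ QJ; have PJ' := inv_comm _ PJ.
have JJ'c : GRing.comm J J' by rewrite /GRing.comm JJ'.
have rL : fred_riesz (- J' * Q).
  apply: fred_rieszM => //; rewrite mulNr mulrN QJ'; exact: eqfr_refl.
pose T := - J' * Q - 1.
have commT C : GRing.comm C J' -> GRing.comm C Q -> GRing.comm C T.
  move=> CJ' CQ; apply: commrB; last exact: commr1.
  by apply: commrM => //; exact: commrN.
have [P1 [_ [fP1 _ _ P1C iJ1]]] := browder_projection (fred_riesz_browder rL).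
rewrite -/T in P1C iJ1; set J1 := T + P1 in iJ1.
have JT : GRing.comm J T by apply: commT => //; exact: commr_sym.
have PT : GRing.comm P T by apply: commT => //; exact: commr_sym.
have JP1 := P1C _ JT; have PP1 := P1C _ PT.
have P1T : GRing.comm P1 T by apply/commr_sym/P1C/commr_refl.
have P1J1 : GRing.comm P1 J1 by apply: commrD => //; exact: commr_refl.
have JJ1 : GRing.comm J J1 by exact: commrD.
have PJ1 : GRing.comm P J1 by exact: commrD.
apply: (@comm_decomposition_browder _ (- (J * J1)) (J * P1 - P)).
- have -> : S = J - P by rewrite /J addrK.
  rewrite [RHS]addrA; have -> : - (J * J1) + J * P1 = J + Q.
    rewrite /J1 mulrDr opprD addrNK /T mulrBr mulr1 mulrA mulrN JJ' mulN1r.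
    by rewrite opprB opprK.
  by rewrite addrAC.
- rewrite -mulN1r; apply: invertibleM; last exact: invertibleM.
  by exists (-1); split; rewrite mulrNN mulr1.
- by apply: finite_rankB => //; exact: finite_rankMl.
- apply/commr_sym/commrN/commrM.
    apply/commr_sym/commrB; last exact: commr_sym.
    by apply: commrM => //; exact: commr_refl.
  apply/commr_sym/commrB; last exact: commr_sym.
  by apply: commrM; exact: commr_sym.
Qed.

(** If [A ≈ J] with [J] invertible, then [J^-1 * (A - Q) ≈ 1 - J^-1 * Q], where
[J^-1] commutes with [Q] modulo finite rank. *)
Lemma weyl_dec_perturbation A Q : fred_riesz Q -> GRing.comm A Q ->
  weyl_dec A -> weyl_dec (A - Q).
Proof.
move=> rQ AQ [J [[J' [JJ' J'J]] AJ]].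
have JQ : J * Q ≈ Q * J.
  apply: (eqfr_trans (B := A * Q)); first exact/eqfrMr/eqfr_sym.
  by rewrite AQ; exact: eqfrMl.
have J'Q : J' * Q ≈ Q * J'.
  have -> : J' * Q = J' * (Q * J) * J' by rewrite -!mulrA JJ' mulr1.
  have -> : Q * J' = J' * (J * Q) * J' by rewrite !mulrA J'J mul1r.
  exact/eqfrMr/eqfrMl/eqfr_sym.
have wJ' : weyl_dec J' by apply: invertible_weyl_dec; exists J.
apply: weyl_dec_cancell wJ' _; apply: eqfr_weyl_dec (fred_riesz_weyl_dec (fred_rieszM rQ J'Q)).
rewrite mulrBr; apply: eqfrB (eqfr_refl _).
by rewrite -[X in eqfr _ X]J'J; exact: eqfrMl.
Qed.

End Perturbation.

(** * Spectral sets and property (Z_Ea) *)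

Section SpectralSets.
Variables (R : realType) (X : completeNormedModType (Cplx R)).
Local Notation K := (Cplx R).
Local Notation bop := (bop X).
Implicit Types (A S Q : bop) (l m : K).

Lemma shift_bopE S l : shift_op S l = (S - l *: (1 : bop)).
Proof. by apply/funext => x; rewrite bopBE bopZE bop1E. Qed.

Lemma invertible_opP A : invertible_op A <-> invertible A.
Proof.
split=> [[U bU [AU UA]]|[B [AB BA]]].
  by exists (Bop bU); split; apply: bopP => x; rewrite bopME bop1E /= ?AU ?UA.
exists B; first by case: B AB BA.
by split=> x; rewrite -bopME ?AB ?BA bop1E.
Qed.

Lemma spectrumP S l : spectrum S l <-> ~ invertible (S - l *: (1 : bop)).
Proof.
by rewrite /spectrum /= shift_bopE; split; apply: contra_not => /invertible_opP.
Qed.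

Lemma weyl_spectrumP S l : weyl_spectrum S l <-> ~ weyl_dec (S - l *: (1 : bop)).
Proof.
rewrite /weyl_spectrum /= shift_bopE.
split; apply: contra_not; first exact: weyl_of_weyl_dec.
exact: weyl_dec_of_weyl.
Qed.

Lemma point_spectrumP S l : point_spectrum S l <->
  exists2 x, x != 0 & (S - l *: (1 : bop)) x = 0.
Proof.
split=> -[x x0 Sx]; exists x => //.
  by rewrite bopBE bopZE bop1E Sx subrr.
by move: Sx; rewrite bopBE bopZE bop1E => /subr0_eq.
Qed.

Lemma bounded_below_inj A : bounded_below A -> forall x, A x = 0 -> x = 0.
Proof.
move=> [c c0 Ac] x Ax; have := Ac x; rewrite Ax normr0.
by rewrite pmulr_rle0// normr_le0 => /eqP.
Qed.

Lemma invertible_bounded_below A : invertible A -> bounded_below A.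
Proof.
move=> [B [_ BA]]; have [b b0 Bb] := op_le_ex B.
exists (b^-1)%:C%C => [|x]; first by rewrite ltcR invr_gt0.
rewrite !nrmE -(rmorphM (real_complex R)) lecR ler_pdivrMl//.
by rewrite -{1}[x]bop1E -BA bopME.
Qed.

Lemma point_sub_approx_point_spectrum S : point_spectrum S `<=` approx_point_spectrum S.
Proof.
move=> l /point_spectrumP[x x0 Sx]; rewrite /approx_point_spectrum /= shift_bopE.
by move=> /bounded_below_inj/(_ x Sx)/eqP; rewrite (negbTE x0).
Qed.

Lemma point_sub_spectrum S : point_spectrum S `<=` spectrum S.
Proof.
move=> l /point_spectrumP[x x0 Sx]; apply/spectrumP => -[B [_ BA]].
by move/eqP: x0; apply; rewrite -[x]bop1E -BA bopME Sx bopr0.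
Qed.

Lemma isolated_approx_point_spectrumP S l :
  isolated (approx_point_spectrum S) l <->
  approx_point_spectrum S l /\ exists2 e : R, 0 < e & forall m, m != 0 -> cabs m < e ->
    bounded_below (S - (l + m) *: (1 : bop)).
Proof.
split=> [[/set_mem al [V lV VS]]|[al [e e0 Se]]].
  split=> //; have [d /= d0 dV] : exists2 d : K, 0 < d & ball l d `<=` V by exact/nbhs_ballP.
  have dE : d = (complex.Re (d : R[i]))%:C%C by rewrite RRe_real // gtr0_real.
  rewrite dE ltcR in d0 dV.
  exists (complex.Re (d : R[i])) => // m m0 me; apply: contrapT => nb.
  have : (V `&` approx_point_spectrum S) (l + m).
    split; last by rewrite /approx_point_spectrum /= shift_bopE.
    apply: dV; rewrite -ball_normE /= opprD addrA subrr sub0r normrN.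
    by rewrite cabsE ltcR.
  rewrite VS /= => /eqP; rewrite -subr_eq0 addrC addKr; exact/negP.
split; first exact/mem_set.
exists (ball l e%:C%C); first by apply: nbhsx_ballx; rewrite ltcR.
apply/seteqP; split=> [m [lm am]|_ ->] /=; last first.
  by split=> //; apply: ballxx; rewrite ltcR.
apply: contrapT => /eqP ml; apply: am; rewrite shift_bopE.
rewrite -[m](subrK l) [m - l + l]addrC; apply: Se; first by rewrite subr_eq0.
by move: lm; rewrite -ball_normE /= cabsE ltcR cabsB.
Qed.

Lemma ascent_finiteP S : (ascent S < +oo)%E <->
  exists p, null_space (S ^+ p) = null_space (S ^+ p.+1).
Proof.
have itE n : iter n S = S ^+ n :> (X -> X) by apply/funext => x; rewrite bopXE.
split=> [|[p Sp]].
  move=> /ereal_inf_lt[_ [n /= Sn _] _].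
  by exists n; rewrite -!itE.
apply: (@le_lt_trans _ _ (p%:R%:E)); last exact: ltry.
by apply: ereal_inf_lbound; exists p => //; rewrite /mkset !itE.
Qed.

Lemma descent_finiteP S : (descent S < +oo)%E <->
  exists p, range (S ^+ p) = range (S ^+ p.+1).
Proof.
have itE n : iter n S = S ^+ n :> (X -> X) by apply/funext => x; rewrite bopXE.
split=> [|[p Sp]].
  move=> /ereal_inf_lt[_ [n /= Sn _] _].
  by exists n; rewrite -!itE.
apply: (@le_lt_trans _ _ (p%:R%:E)); last exact: ltry.
by apply: ereal_inf_lbound; exists p => //; rewrite /mkset !itE.
Qed.

Lemma finite_rank_polesP S l : finite_rank_poles S l <->
  spectrum S l /\ browder (S - l *: (1 : bop)).
Proof.
rewrite /finite_rank_poles /pole /= shift_bopE.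
split=> [[[sl /ascent_finiteP asc /descent_finiteP dsc] fN]|[sl [fN asc dsc]]].
  by [].
by split=> //; split=> //; [exact/ascent_finiteP|exact/descent_finiteP].
Qed.

(** An injective Weyl operator is invertible. *)
Lemma weyl_dec_spectrum_eigenvalue S l : spectrum S l ->
  weyl_dec (S - l *: (1 : bop)) -> point_spectrum S l.
Proof.
move=> /spectrumP nl wl; apply: contrapT => npt; apply: nl.
apply: weyl_dec_inj_invertible wl _ => x Sx; apply: contrapT => /eqP x0.
by apply: npt; apply/point_spectrumP; exists x.
Qed.

Lemma finite_rank_poles_sub_Ea S :
  finite_rank_poles S `<=` isolated_approx_eigenvalues S.
Proof.
move=> l /finite_rank_polesP[sl /browder_punctured[wl [e e0 Se]]].
have pl := weyl_dec_spectrum_eigenvalue sl wl; split=> //.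
apply/isolated_approx_point_spectrumP; split.
  exact: point_sub_approx_point_spectrum.
exists e => // m m0 me; apply: invertible_bounded_below.
by rewrite scalerDl opprD addrA; exact: Se.
Qed.

(** If the shifted operator is not invertible, the property makes [l] isolated in the
approximate point spectrum, so that arbitrarily small further shifts are
injective. *)
Lemma property_ZEa_browder S l : property_ZEa S ->
  weyl_dec (S - l *: (1 : bop)) -> browder (S - l *: (1 : bop)).
Proof.
move=> ZS wl; have [il|nl] := pselect (invertible (S - l *: (1 : bop))).
  exact: invertible_browder.
have : isolated_approx_eigenvalues S l.
  by rewrite -ZS; split; [exact/spectrumP|move=> /weyl_spectrumP].
move=> [/isolated_approx_point_spectrumP[_ [e e0 Se]] _].
apply: weyl_dec_isolated_browder wl _ => d d0; pose r := Num.min (d / 2) (e / 2).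
have r0 : 0 < r by rewrite lt_min !divr_gt0.
have rd : r <= d / 2 by rewrite ge_min lexx.
have re : r <= e / 2 by rewrite ge_min lexx orbT.
have cr : cabs (r%:C%C : K) = r by rewrite cabs_real ger0_norm// ltW.
exists r%:C%C; first by rewrite cr; lra.
move=> x Sx; have rN0 : r%:C%C != 0 :> K by apply/eqP => /complexI; lra.
have cre : cabs (r%:C%C : K) < e by rewrite cr; lra.
apply: (bounded_below_inj (Se _ rN0 cre)).
by rewrite scalerDl opprD addrA bopBE Sx bopZE bop1E subrr.
Qed.

(** The first hypothesis is Browder's theorem for [S]; the inclusion opposite to the
second one always holds. *)
Lemma property_ZEa_of_browder S :
  (forall l, weyl_dec (S - l *: (1 : bop)) -> browder (S - l *: (1 : bop))) ->
  isolated_approx_eigenvalues S `<=` finite_rank_poles S -> property_ZEa S.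
Proof.
move=> bS sub; apply/seteqP; split=> [l [sl nW]|l /sub/finite_rank_polesP[sl bl]].
  apply: finite_rank_poles_sub_Ea; apply/finite_rank_polesP; split=> //.
  by apply: bS; apply: contrapT => nwl; apply: nW; apply/weyl_spectrumP.
by split=> // /weyl_spectrumP; apply; case: (browder_punctured bl).
Qed.

End SpectralSets.

Section CommutingRiesz.
Variables (R : realType) (X : completeNormedModType (Cplx R)).
Local Notation K := (Cplx R).
Local Notation bop := (bop X).
Variables (T Q : bop).
Hypotheses (rQ : fred_riesz Q) (TQ : GRing.comm T Q).

Lemma fred_rieszN : fred_riesz (- Q).
Proof.
have -> : - Q = (- 1) * Q by rewrite mulN1r.
by apply: fred_rieszM => //; rewrite mulN1r mulrN1; exact: eqfr_refl.
Qed.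

Lemma shift_perturbation (l : K) : T + Q - l *: (1 : bop) = T - l *: (1 : bop) + Q.
Proof. by rewrite addrAC. Qed.

Lemma comm_shift (l : K) : GRing.comm (T - l *: (1 : bop)) Q.
Proof. by apply/commr_sym/commrB; [exact: commr_sym|exact: scalar_comm]. Qed.

Lemma browder_shift_perturbation (l : K) :
  browder (T + Q - l *: (1 : bop)) <-> browder (T - l *: (1 : bop)).
Proof.
rewrite shift_perturbation; split; last exact: browder_perturbation (comm_shift l).
move=> b; rewrite -[T - _](addrK Q); apply: browder_perturbation b.
  exact: fred_rieszN.
apply: commrN; apply/commr_sym/commrD; last exact: commr_refl.
exact/commr_sym/comm_shift.
Qed.

Lemma weyl_shift_perturbation (l : K) :
  weyl_dec (T + Q - l *: (1 : bop)) -> weyl_dec (T - l *: (1 : bop)).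
Proof.
rewrite shift_perturbation => w; rewrite -[T - _](addrK Q).
apply: weyl_dec_perturbation w => //.
apply/commr_sym/commrD; last exact: commr_refl.
exact/commr_sym/comm_shift.
Qed.

(** Weyl shifts pass from [T + Q] to [T] and Browder shifts pass both ways, so Browder's
theorem, which property (Z_Ea) contains, carries over from [T] to [T + Q]; what
remains is to compare the isolated approximate eigenvalues with the finite-rank
poles, separately on and off the spectrum of [T]. *)
Lemma property_ZEa_perturbation : property_ZEa T ->
  [<-> property_ZEa (T + Q);
       isolated_approx_eigenvalues (T + Q) = finite_rank_poles (T + Q);
       isolated_approx_eigenvalues (T + Q) `&` spectrum T
         `<=` finite_rank_poles T].
Proof.
move=> ZT; tfae.
- move=> ZTQ; apply/seteqP; split; last exact: finite_rank_poles_sub_Ea.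
  rewrite -ZTQ => l [sl nW]; apply/finite_rank_polesP; split=> //.
  apply: property_ZEa_browder ZTQ _.
  by apply: contrapT => nwl; apply: nW; apply/weyl_spectrumP.
- move=> EP l [El sTl]; rewrite EP in El; have [_ bl] := (finite_rank_polesP _ _).1 El.
  by apply/finite_rank_polesP; split=> //; exact/browder_shift_perturbation.
- move=> ET; apply: property_ZEa_of_browder => [l wl|l El].
    apply/browder_shift_perturbation/property_ZEa_browder => //.
    exact: weyl_shift_perturbation.
  apply/finite_rank_polesP; split; first by case: El => _ /point_sub_spectrum.
  apply/browder_shift_perturbation.
  have [sTl|/spectrumP nl] := pselect (spectrum T l).
    by case: ((finite_rank_polesP _ _).1 (ET l (conj El sTl))).
  by apply: invertible_browder; apply: contrapT.
Qed.

End CommutingRiesz.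

Theorem theorem3p4 (R : realType) (X : completeNormedModType (Cplx R))
    (infX : ~ finite_dim [set: X])
    (Q T : {linear X -> X}) (bddQ : bounded_op Q) (bddT : bounded_op T)
    (rieszQ : riesz Q) (commTQ : forall x, T (Q x) = Q (T x))
    (ZEaT : property_ZEa T) :
  [<-> property_ZEa (T \+ Q);
       isolated_approx_eigenvalues (T \+ Q) = finite_rank_poles (T \+ Q);
       isolated_approx_eigenvalues (T \+ Q) `&` spectrum T
         `<=` finite_rank_poles T].
Proof.
pose T' := Bop bddT; pose Q' := Bop bddQ.
have -> : T \+ Q = T' + Q' by apply/funext => x; rewrite bopDE.
apply: (@property_ZEa_perturbation _ _ T' Q' _ _ ZEaT).
  move=> m m0; apply: fredholm_finvertible; rewrite -shift_bopE.
  exact: rieszQ.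
by apply: bopP => x; rewrite !bopME; exact: commTQ.
Qed.
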